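(* Let $k$ be a positive integer and let $G$ be a graph such that $|E(G)|$ and every vertex degree $d_G(v)$ are divisible by $k$. Let $Q$ be the set of all vertices $v$ with $d_G(v)/k$ odd. If $d_G(X)\ge 3k-2$ for every vertex set $X$ with $|X\cap Q|$ odd, then $G$ can be edge-decomposed into $k$ factors $G_1,\ldots,G_k$ such that $d_{G_i}(v)=d_G(v)/k$ for each $i$ and each vertex $v$.
   Context: Graphs are finite and may have loops and multiple edges; a loop contributes $2$ to the degree. For a vertex set $X$, $d_G(X)$ denotes the number of edges with exactly one end in $X$. A factor is a spanning subgraph; ''edge-decomposed into factors'' means the edge set is partitioned into the edge sets of spanning subgraphs. *)

(* Defs.v *)
From HB Require Import structures.
From mathcomp Require Import all_boot.

Set Implicit Arguments.
Unset Strict Implicit.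
Unset Printing Implicit Defensive.

(* Finite graphs with loops and multiple edges (MathComp). The ends of an edge
   are stored as an ordered pair, but no definition below depends on the order;
   a loop is an edge whose two ends coincide. *)
Record mgraph (V : finType) := MGraph {
  edge : finType;
  ends : edge -> V * V
}.

Section MGraph.
Variables (V : finType) (G : mgraph V).

(* A loop at v is counted once in each summand, hence contributes 2. *)
Definition deg (v : V) : nat :=
  #|[set e : edge G | (ends e).1 == v]| + #|[set e : edge G | (ends e).2 == v]|.

Definition cut_edges (X : {set V}) : {set edge G} :=
  [set e | ((ends e).1 \in X) (+) ((ends e).2 \in X)].

Definition cut_size (X : {set V}) : nat := #|cut_edges X|.

Definition factor (F : {set edge G}) : mgraph V :=
  @MGraph V {e : edge G | e \in F} (fun e => ends (val e)).

Definition edge_decomposition (k : nat) (F : 'I_k -> {set edge G}) : Prop :=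
  (forall i j : 'I_k, i != j -> [disjoint F i & F j]) /\
  \bigcup_(i < k) F i = [set: edge G].

End MGraph.

(* Main.v *)
Require Import Defs.
From mathcomp Require Import all_boot.
From mathcomp Require Import all_order all_algebra zify.

(* If G has an orientation in which every out-degree and every in-degree is
   divisible by k, split each vertex into an out-copy and an in-copy and colour
   the edges of the resulting bipartite graph with k colours, minimising the
   sum of the squares of the colour degrees.  Two colours that are unbalanced at
   a vertex could be rebalanced by a balanced orientation of the bipartite graph
   they span, so a minimiser splits every degree exactly into k equal parts.

   The orientation is required to have out-degree minus in-degree congruent
   modulo 2k to k on Q and to 0 elsewhere.  It is found by the method of Lovász,
   Thomassen, Wu and Zhang.  Let rho be the distance to 2kZ.  One generalises to
   arbitrary residues t(v) and to a graph with a root all of whose edges are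
   already oriented, and assumes d(A) >= 2k - 2 + rho(t(A)) for the vertex sets A
   avoiding the root.  A set A attaining this bound is contracted; the graph
   obtained is oriented by induction, and then A itself, with its complement
   contracted to a new root.  Once no such set is left, edges can be split off
   at vertices with t(v) = 0 and deleted between vertices whose residues have
   opposite signs, the residue k counting for both signs.  If all residues have
   the same sign, new edges to the root raise one of them to k.

   Here the bound is known only for odd sets, that is for rho(t(A)) <> 0.  Sets
   with t(A) = 0 may violate it as long as there is no root or t is not 0 at the
   root; a minimal such set is contracted only after all vertices with t(v) = 0
   have been split away. *)

Set Implicit Arguments.
Unset Strict Implicit.
Unset Printing Implicit Defensive.

Import Order.TTheory GRing.Theory Num.Theory.

(** * Distance to the multiples of [2k] *)

Section Rho.
Local Open Scope ring_scope.
Variable k : nat.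
Hypothesis k_gt0 : (0 < k)%N.
Local Notation K := (2 * k%:Z).

Definition rho (m : int) : int := Num.min (modz m K) (K - modz m K).

Lemma modzK_decomp (m : int) :
  exists q r, [/\ m = q * K + r, modz m K = r, 0 <= r & r < K].
Proof.
exists (divz m K), (modz m K); split=> //; first exact: divz_eq.
- by rewrite modz_ge0 //; lia.
- by rewrite ltz_pmod //; lia.
Qed.

(** With [rho_attained] this makes [rho m] the least absolute value in the class of [m] modulo [2k],
    whence subadditivity and symmetry follow. *)
Lemma rho_le_shift (m z : int) : rho m <= `|m + K * z|.
Proof.
rewrite /rho; have [q [r [-> -> r0 rK]]] := modzK_decomp m.
have -> : q * K + r + K * z = r + K * (q + z) by lia.
have [w0|w0] : 0 <= q + z \/ q + z <= -1 by lia.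
- have : 0 <= K * (q + z) by nia. lia.
- have : K * (q + z) <= - K by nia. lia.
Qed.

Lemma rho_attained (m : int) : exists z, rho m = `|m + K * z|.
Proof.
rewrite /rho; have [q [r [-> -> r0 rK]]] := modzK_decomp m.
have [le|lt] : r <= K - r \/ K - r < r by lia.
- by exists (- q); have -> : q * K + r + K * - q = r; lia.
- by exists (- q - 1); have -> : q * K + r + K * (- q - 1) = r - K; lia.
Qed.

Lemma rho_bounds m : 0 <= rho m <= k%:Z.
Proof. by rewrite /rho; have [q [r [_ -> r0 rK]]] := modzK_decomp m; lia. Qed.

Lemma rho_le_norm m : rho m <= `|m|.
Proof. by have := rho_le_shift m 0; rewrite mulr0 addr0. Qed.

Lemma rhoD m n : rho (m + n) <= rho m + rho n.
Proof.
have [[y ->] [z ->]] := (rho_attained m, rho_attained n).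
have := rho_le_shift (m + n) (y + z).
have -> : m + n + K * (y + z) = (m + K * y) + (n + K * z) by lia.
lia.
Qed.

Lemma rhoN m : rho (- m) = rho m.
Proof.
have le n : rho (- n) <= rho n.
  have [z ->] := rho_attained n; have := rho_le_shift (- n) (- z).
  by rewrite mulrN -opprD normrN.
by have := le m; have := le (- m); rewrite opprK; lia.
Qed.

Lemma dvdz_rho m : (m \in dvdz K) = (rho m == 0).
Proof.
have -> : (m \in dvdz K) = (modz m K == 0).
  exact: (sameP dvdz_mod0P eqP).
by rewrite /rho; have [q [r [_ -> r0 rK]]] := modzK_decomp m; lia.
Qed.

Lemma rho_mod m n : (m - n \in dvdz K) -> rho m = rho n.
Proof.
rewrite dvdz_rho => /eqP mn0; have := rhoD n (m - n); have := rhoD m (- (m - n)).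
have -> : n + (m - n) = m by lia. have -> : m + - (m - n) = n by lia.
by rewrite rhoN; lia.
Qed.

Lemma rho_parity m : m + rho m \in dvdz 2.
Proof.
have [z ->] := rho_attained m.
have -> : K * z = 2 * (k%:Z * z) by lia. lia.
Qed.

Lemma rho_lip m n : rho m <= rho n + `|m - n|.
Proof. by have := rhoD n (m - n); have := rho_le_norm (m - n); rewrite subrKC; lia. Qed.

(* The residue k modulo 2k is both [pos] and [neg]. *)
Definition pos m := rho (m - 1) == rho m - 1.
Definition neg m := rho (m + 1) == rho m - 1.

Lemma negN m : neg m = pos (- m).
Proof. by rewrite /neg /pos -opprD !rhoN. Qed.

Lemma rho_small q r : - k%:Z <= r <= k%:Z -> rho (q * K + r) = `|r|.
Proof.
move=> rk; have := rho_le_shift (q * K + r) (- q).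
have -> : q * K + r + K * - q = r by lia.
have [z ->] := rho_attained (q * K + r).
have -> : q * K + r + K * z = r + K * (q + z) by lia.
have [|[|]] : q + z = 0 \/ 1 <= q + z \/ q + z <= -1 by lia.
- by move=> ->; lia.
- move=> w; have : K <= K * (q + z) by nia. lia.
- move=> w; have : K * (q + z) <= - K by nia. lia.
Qed.

Lemma pos_or_neg m : m \notin dvdz K -> pos m || neg m.
Proof.
have [q [r [Em Er r0 rK]]] := modzK_decomp m.
have Erho : rho m = Num.min r (K - r) by rewrite /rho Er.
rewrite dvdz_rho /pos /neg => nz; apply/orP.
have [le|lt] : r <= k%:Z \/ k%:Z < r by lia.
- left; rewrite (_ : m - 1 = q * K + (r - 1)); last by lia.
  by rewrite rho_small; lia.
- right; rewrite (_ : m + 1 = (q + 1) * K + (r + 1 - K)); last by lia.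
  by rewrite rho_small; lia.
Qed.

(** The hypotheses leave only the residues from 1 to [k - 1], and adding [j] to such a residue gives
    [k]. *)
Lemma pos_raise m (j := k%:Z - rho m) : pos m -> ~~ neg m ->
  [/\ 1 <= j <= k%:Z - 1 & rho (m + j + 1) = k%:Z - 1].
Proof.
rewrite {}/j /pos /neg.
have [q [r [Em Er r0 rK]]] := modzK_decomp m.
have Erho : rho m = Num.min r (K - r) by rewrite /rho Er.
have [] : k%:Z < r \/ r <= k%:Z by lia.
  move=> lt; rewrite (_ : m - 1 = (q + 1) * K + (r - 1 - K)); last lia.
  by rewrite rho_small; lia.
have [rk|ltr le] : r = k%:Z \/ r != k%:Z by lia.
  rewrite (_ : m + 1 = (q + 1) * K + (k%:Z + 1 - K)); last lia.
  by rewrite rho_small; lia.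
have [r00|rn0] : r = 0 \/ r != 0 by lia.
  rewrite (_ : m - 1 = q * K + -1); last lia.
  by rewrite rho_small; lia.
move=> _ _; rewrite Erho (_ : m + _ + 1 = (q + 1) * K + (1 - k%:Z)); last lia.
by rewrite rho_small; lia.
Qed.
End Rho.

(** * Signed boundaries, orientations and splitting off *)

Section Boundary.
Local Open Scope ring_scope.
Variables V E : finType.
Implicit Types (h : E -> V * V) (S : {set E}) (A B : {set V}).

Definition sg (b : bool) : int := if b then 1 else -1.

Definition bnd h e A : int := ((h e).1 \in A)%:Z - ((h e).2 \in A)%:Z.

Definition net h S (s : E -> bool) A := \sum_(e in S) sg (s e) * bnd h e A.

Definition cutsz h S A : int := \sum_(e in S) `|bnd h e A|.

Lemma sum_indic A (x : V) : \sum_(v in A) (x == v)%:Z = (x \in A)%:Z.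
Proof.
rewrite (eq_bigr (fun v => if v == x then 1 else 0)); last first.
  by move=> v _; rewrite eq_sym; case: eqP.
rewrite -big_mkcondr /=; case: (boolP (x \in A)) => xA.
  by rewrite (big_pred1 x) // => v /=; case: eqP => [->|]; rewrite ?xA ?andbF.
by rewrite big_pred0 // => v; case: eqP => [->|]; rewrite ?(negPf xA) ?andbF.
Qed.

Lemma sum_bnd h e A : \sum_(v in A) bnd h e [set v] = bnd h e A.
Proof.
rewrite /bnd sumrB -!sum_indic.
by congr (_ - _); apply: eq_bigr => v _; rewrite inE.
Qed.

Lemma sum_net h S s A : \sum_(v in A) net h S s [set v] = net h S s A.
Proof.
rewrite /net exchange_big /=; apply: eq_bigr => e _.
by rewrite -big_distrr /= sum_bnd.
Qed.

Lemma cutsz_ge0 h S A : 0 <= cutsz h S A.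
Proof. exact: sumr_ge0. Qed.

Lemma cutsz_parity h S A :
  cutsz h S A + \sum_(v in A) cutsz h S [set v] \in dvdz 2.
Proof.
rewrite exchange_big /= -big_split /=; apply: rpred_sum => e _.
have even_norm (x y : int) : x + y \in dvdz 2 -> `|y| + x \in dvdz 2 by lia.
apply: even_norm; rewrite -sum_bnd -big_split /=.
by apply: rpred_sum => v _ /=; lia.
Qed.

Lemma cutszD1 h S e A : e \in S -> cutsz h S A = `|bnd h e A| + cutsz h (S :\ e) A.
Proof. by move=> eS; rewrite /cutsz (big_setD1 e). Qed.

Lemma netD1 h S s e A : e \in S -> net h S s A = sg (s e) * bnd h e A + net h (S :\ e) s A.
Proof. by move=> eS; rewrite /net (big_setD1 e). Qed.

Lemma eq_net h h' S s s' A : {in S, h =1 h'} -> {in S, s =1 s'} ->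
  net h S s A = net h' S s' A.
Proof. by move=> hh ss; apply: eq_bigr => e eS; rewrite /bnd hh // ss. Qed.

Lemma eq_cutsz h h' S A : {in S, h =1 h'} -> cutsz h S A = cutsz h' S A.
Proof. by move=> hh; apply: eq_bigr => e eS; rewrite /bnd hh. Qed.

Definition joins h e (x v : V) := ((h e) == (x, v)) || (h e == (v, x)).

Lemma joins_bnd h e x v : joins h e x v ->
  exists b, forall A, bnd h e A = sg b * ((x \in A)%:Z - (v \in A)%:Z).
Proof.
by case/orP=> /eqP E1; [exists true | exists false] => A; rewrite /bnd E1 /sg /=; lia.
Qed.

Definition loop h e := (h e).1 == (h e).2.

Definition redirect h e xy : E -> V * V := fun e' => if e' == e then xy else h e'.

Definition resign (s : E -> bool) e b : E -> bool := fun e' => if e' == e then b else s e'.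

(** [r] collects the edges that splitting off leaves alone, so the two cuts differ only through the
    positions of [x], [y] and [v]. *)
Lemma cutsz_redirect h S e1 e2 x y v : e1 \in S -> e2 \in S -> e1 != e2 ->
    joins h e1 x v -> joins h e2 y v -> exists2 r : {set V} -> int, forall A, 0 <= r A &
  forall A, cutsz h S A = `|(x \in A)%:Z - (v \in A)%:Z| + `|(y \in A)%:Z - (v \in A)%:Z| + r A
   /\ cutsz (redirect h e1 (x, y)) (S :\ e2) A = `|(x \in A)%:Z - (y \in A)%:Z| + r A.
Proof.
move=> e1S e2S e12 /joins_bnd[b1 H1] /joins_bnd[b2 H2].
have e1S' : e1 \in S :\ e2 by rewrite !inE e12.
exists (cutsz h (S :\ e2 :\ e1)) => A; first exact: cutsz_ge0.
rewrite (cutszD1 _ _ e2S) !(cutszD1 _ _ e1S') H1 H2; split.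
  by rewrite /sg; case: (b1); case: (b2) => /=; lia.
rewrite [bnd (redirect _ _ _) _ _]/bnd /redirect eqxx -/(redirect _ _ _); congr (_ + _).
by apply: eq_cutsz => e; rewrite !inE /redirect => /andP[/negPf ->].
Qed.

Lemma cutsz_joins h S e x y A : e \in S -> joins h e x y ->
  cutsz h S A = `|(x \in A)%:Z - (y \in A)%:Z| + cutsz h (S :\ e) A.
Proof.
move=> eS /joins_bnd[b Hb]; rewrite (cutszD1 _ _ eS) Hb.
by rewrite /sg; case: b {Hb} => /=; lia.
Qed.

(* Splitting off: a solution of the graph where the path x - v - y has been
   replaced by the edge xy lifts to the original graph. *)
Lemma split_net h S s e1 e2 x y v : e1 \in S -> e2 \in S -> e1 != e2 ->
    joins h e1 x v -> joins h e2 y v ->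
  exists s', forall A, net h S s' A = net (redirect h e1 (x, y)) (S :\ e2) s A.
Proof.
move=> e1S e2S e12 /joins_bnd[b1 H1] /joins_bnd[b2 H2].
(* Both halves of the path inherit the direction of the new edge; [b1] and [b2] correct for the
   stored order of the ends. *)
exists (resign (resign s e1 (s e1 == b1)) e2 (s e1 != b2)) => A.
rewrite (netD1 _ _ _ e2S) (netD1 _ _ _ (_ : e1 \in S :\ e2)); last by rewrite !inE e12.
rewrite [in RHS](netD1 _ _ _ (_ : e1 \in S :\ e2)); last by rewrite !inE e12.
rewrite /resign eqxx (negPf e12) eqxx H1 H2.
rewrite [bnd (redirect _ _ _) _ _]/bnd /redirect eqxx addrA -/(redirect _ _ _); congr (_ + _).
  by rewrite /sg; case: (s e1); case: (b1); case: (b2) => /=; lia.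
apply: eq_net => e; rewrite !inE => /andP[/negPf n1 /andP[/negPf n2 _]];
  by rewrite /redirect ?n1 ?n2.
Qed.

Lemma resign_net h S s e x y d : e \in S -> joins h e x y ->
  exists s', forall A, net h S s' A =
    sg d * ((x \in A)%:Z - (y \in A)%:Z) + net h (S :\ e) s A.
Proof.
move=> eS /joins_bnd[b Hb]; exists (resign s e (d == b)) => A.
rewrite (netD1 _ _ _ eS) {1}/resign eqxx Hb; congr (_ + _).
  by rewrite /sg; case: d; case: b {Hb} => /=; lia.
by apply: eq_net => // e'; rewrite !inE /resign => /andP[/negPf ->].
Qed.

Lemma joins_ends h e v : ((h e).1 == v) || ((h e).2 == v) -> exists x, joins h e x v.
Proof.
case E1: (h e) => [a b] /= /orP[]/eqP <-; rewrite /joins E1.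
  by exists b; rewrite eqxx orbT.
by exists a; rewrite eqxx.
Qed.

(** Two non-loop edges at a common vertex can be split off without changing any net out-degree. Once
    no such pair is left, at most one non-loop edge meets each vertex. *)
Lemma balanced_orientation h S :
  exists s, forall v, `|net h S s [set v]| <= 1.
Proof.
have [n] := ubnP #|S|; elim: n h S => // n IHn h S; rewrite ltnS => leS.
have [/existsP[v /existsP[e1 /existsP[e2 /and5P[e1S e2S e12 nl1 /andP[nl2 /andP[v1 v2]]]]]]|] := boolP
  [exists v, exists e1, exists e2, [&& e1 \in S, e2 \in S, e1 != e2, ~~ loop h e1, ~~ loop h e2,
     ((h e1).1 == v) || ((h e1).2 == v) & ((h e2).1 == v) || ((h e2).2 == v)]].
  have [x j1] := joins_ends v1; have [y j2] := joins_ends v2.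
  have [|s Hs] := IHn (redirect h e1 (x, y)) (S :\ e2).
    by move: leS; rewrite (cardsD1 e2) e2S.
  have [s' Es'] := split_net s e1S e2S e12 j1 j2.
  by exists s' => u; rewrite Es'.
move=> none; exists (fun=> true) => v; rewrite /net.
have [/exists_inP[e eS ev]|/exists_inPn no] := boolP
   [exists e in S, ~~ loop h e && (((h e).1 == v) || ((h e).2 == v))].
  rewrite (big_setD1 e) //= big1 ?addr0; last first.
    move=> e'; rewrite !inE => /andP[e'e e'S].
    move: none; rewrite negb_exists => /forallP/(_ v); rewrite negb_exists => /forallP/(_ e).
    rewrite negb_exists => /forallP/(_ e'); rewrite eS e'S eq_sym e'e /=.
    move: ev => /andP[-> ->] /=; rewrite /loop /bnd !inE /sg /=.
    by case: eqP => [->|] /=; [lia|]; case: eqP; case: eqP.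
  by rewrite /sg /bnd; lia.
rewrite big1 // => e eS; have := no e eS; rewrite /loop /bnd !inE /sg.
by case: eqP => [->|] /=; [lia|]; case: eqP; case: eqP.
Qed.

End Boundary.

(** * Rooted instances of the modular orientation problem *)

Section ModularOrientation.
Local Open Scope ring_scope.
Variables (V E : finType) (k : nat).
Hypothesis k_gt1 : (1 < k)%N.
Local Notation K := (2 * k%:Z).
Local Notation rho := (rho k).
Implicit Types (h : E -> V * V) (S : {set E}) (A B : {set V}) (f : V -> int).

Definition tot f A : int := \sum_(v in A) f v.

(* The root is not a vertex: [stubs v] is the number of edges joining v to it,
   [target v] is the net out-degree wanted at v when these edges are counted, and
   [demand v] the one wanted when they are not; the latter encodes their
   orientation. *)
Record inst := Inst {
  verts : {set V};
  edges : {set E};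
  ept : E -> V * V;
  target : V -> int;
  demand : V -> int;
  stubs : V -> int
}.

Implicit Types I : inst.

Definition solvable I := exists s, forall v, v \in verts I ->
  net (ept I) (edges I) s [set v] - demand I v \in dvdz K.

Definition load I A : int := cutsz (ept I) (edges I) A + tot (stubs I) A.

Definition large I A := K - 2 + rho (tot (target I) A) <= load I A.

(* The root is isolated, or the residue wanted at the root is not 0. *)
Definition exempting I := (tot (stubs I) (verts I) == 0) || (tot (target I) (verts I) \notin dvdz K).

(* The vertex v0 may violate the cut condition; this allows splitting it off
   completely. *)
Record admissible I (v0 : V) : Prop := Admissible {
  adm_ends : forall e, e \in edges I ->
    ((ept I e).1 \in verts I) && ((ept I e).2 \in verts I);
  adm_stubs_parity : forall v, v \in verts I ->
    stubs I v + demand I v + target I v \in dvdz 2;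
  adm_demand_parity : forall v, v \in verts I ->
    cutsz (ept I) (edges I) [set v] + demand I v \in dvdz 2;
  adm_gap : forall v, v \in verts I -> `|demand I v - target I v| <= stubs I v;
  adm_sum : tot (demand I) (verts I) \in dvdz K;
  adm_root : tot (stubs I) (verts I) <= K - 2 + rho (tot (target I) (verts I));
  adm_cut : forall A, A != set0 -> A \proper verts I ->
    large I A \/ (tot (target I) A \in dvdz K /\ (exempting I \/ A = [set v0]))
}.

Lemma load_parity I v0 A : admissible I v0 -> A \subset verts I ->
  load I A + tot (target I) A \in dvdz 2.
Proof.
move=> [_ p1 p2 _ _ _ _] /subsetP sA.
have := cutsz_parity (ept I) (edges I) A.
have s1 : tot (stubs I) A + tot (demand I) A + tot (target I) A \in dvdz 2.
  by rewrite /tot -!big_split /=; apply: rpred_sum => v vA; apply: p1; apply: sA.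
have s2 : \sum_(v in A) cutsz (ept I) (edges I) [set v]
           + tot (demand I) A \in dvdz 2.
  by rewrite /tot -!big_split /=; apply: rpred_sum => v vA; apply: p2; apply: sA.
by rewrite /load; move: (\sum_(v in A) _) s2; lia.
Qed.

(** By parity, a load above the bound exceeds it by at least 2. *)
Lemma slack I v0 A : admissible I v0 -> A \subset verts I ->
  ~~ (load I A <= K - 2 + rho (tot (target I) A)) ->
  K + rho (tot (target I) A) <= load I A.
Proof.
move=> adm sA; have := load_parity adm sA.
have := rho_parity (ltnW k_gt1) (tot (target I) A).
lia.
Qed.

(** * Identification of vertices *)

Section Quotient.
Variables (I : inst) (p : V -> V).

Definition push f u : int := \sum_(v in verts I | p v == u) f v.
Definition pull B := [set v in verts I | p v \in B].

(** Edges within a class become loops, so the edge set is kept and orientations carry over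
    unchanged. *)
Definition quotient := Inst [set p v | v in verts I] (edges I)
  (fun e => (p (ept I e).1, p (ept I e).2))
  (push (target I)) (push (demand I)) (push (stubs I)).

Lemma tot_push f B : tot (push f) B = tot f (pull B).
Proof.
rewrite /tot /push [RHS](eq_bigl (fun v => (v \in verts I) && (p v \in B))); last first.
  by move=> v; rewrite inE.
rewrite [RHS](partition_big p (mem B)) /=; last by move=> v /andP[].
apply: eq_bigr => u uB; apply: eq_bigl => v.
by case: eqP => [->|]; rewrite ?uB ?andbT ?andbF.
Qed.

Lemma pull_verts : pull [set p v | v in verts I] = verts I.
Proof.
by apply/setP=> v; rewrite inE; case: (boolP (v \in _)) => //= vX; rewrite imset_f.
Qed.

Variable v0 : V.
Hypothesis adm : admissible I v0.

Lemma quotient_bnd e B : e \in edges I ->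
  bnd (ept quotient) e B = bnd (ept I) e (pull B).
Proof. by move=> /(adm_ends adm)/andP[e1 e2]; rewrite /bnd /= !inE e1 e2. Qed.

Lemma quotient_cutsz B :
  cutsz (ept quotient) (edges quotient) B = cutsz (ept I) (edges I) (pull B).
Proof. by apply: eq_bigr => e eS; rewrite quotient_bnd. Qed.

Lemma quotient_load B : load quotient B = load I (pull B).
Proof. by rewrite /load tot_push quotient_cutsz. Qed.

Lemma push_tot f u : push f u = tot f (pull [set u]).
Proof. by rewrite -tot_push /tot big_set1. Qed.

(** A vertex set of the quotient has the same load and the same total target as its preimage in
    [I]. *)
Lemma quotient_admissible : admissible quotient (p v0).
Proof.
have [ends p1 p2 gap sum root cut] := adm.
split=> /=.
- by move=> e /ends/andP[e1 e2]; rewrite !imset_f.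
- move=> u _; rewrite -!big_split /=.
  by apply: rpred_sum => v /andP[/p1].
- move=> u _; rewrite [cutsz _ _ _]quotient_cutsz push_tot.
  have := cutsz_parity (ept I) (edges I) (pull [set u]).
  have : \sum_(v in pull [set u]) cutsz (ept I) (edges I) [set v]
           + tot (demand I) (pull [set u]) \in dvdz 2.
    by rewrite -big_split /=; apply: rpred_sum => v; rewrite inE => /andP[/p2].
  set x := \sum_(v in _) _; lia.
- move=> u _; rewrite -sumrB; apply: le_trans (ler_norm_sum _ _ _) _.
  by apply: ler_sum => v /andP[/gap].
- by rewrite tot_push pull_verts.
- by rewrite !tot_push pull_verts.
move=> B /set0Pn[u uB] /properP[sB [u' /imsetP[v' v'X ->] nB]].
have [|||[zB ex]] := cut (pull B).
- have /imsetP[v vX Eu] := subsetP sB _ uB.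
  by apply/set0Pn; exists v; rewrite inE vX -Eu.
- apply/properP; split; first by apply/subsetP => v; rewrite inE => /andP[].
  by exists v'; rewrite // inE v'X.
- by rewrite /large quotient_load tot_push; left.
right; rewrite tot_push; split=> //.
case: ex => [fr|Ep]; [left|right]; first by rewrite /exempting !tot_push pull_verts.
apply/eqP; rewrite eqEsubset; apply/andP; split; last first.
  rewrite sub1set; suff : v0 \in pull B by rewrite inE => /andP[].
  by rewrite Ep set11.
apply/subsetP=> w wB; have /imsetP[v vX Ew] := subsetP sB _ wB.
have : v \in pull B by rewrite inE vX -Ew.
by rewrite Ep !inE => /eqP <-; rewrite Ew.
Qed.

End Quotient.

(** The hypothesis excludes edges inside [B]; a non-loop among them would count twice on the left
    and not at all on the right. *)
Lemma sum_abs_bnd h e B : ((h e).1 \notin B) || ((h e).2 \notin B) ->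
  \sum_(v in B) `|bnd h e [set v]| = `|bnd h e B|.
Proof.
case/orP=> nB.
  rewrite (eq_bigr (fun v => ((h e).2 == v)%:Z)) => [|v vB].
    by rewrite sum_indic /bnd (negPf nB); lia.
  rewrite /bnd !inE; case: eqP => [E1|_]; last by lia.
  by move: nB; rewrite E1 vB.
rewrite (eq_bigr (fun v => ((h e).1 == v)%:Z)) => [|v vB].
  by rewrite sum_indic /bnd (negPf nB); lia.
rewrite /bnd !inE; case: (_ =P v) => [E1|_]; case: (_ =P v) => [E2|_]; try lia.
all: by move: nB; rewrite E2 vB.
Qed.

(** * Restriction to a vertex set, and contraction *)

Section Inside.
Variables (I : inst) (v0 : V) (A : {set V}) (s1 : E -> bool).
Let inner := [set e in edges I | ((ept I e).1 \in A) && ((ept I e).2 \in A)].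

(* The edges leaving A become stubs, oriented by s1. *)
Definition inside := Inst A inner (ept I) (target I)
  (fun v => demand I v - net (ept I) (edges I :\: inner) s1 [set v])
  (fun v => stubs I v + \sum_(e in edges I :\: inner) `|bnd (ept I) e [set v]|).

Lemma setI_inner : edges I :&: inner = inner.
Proof. by apply/setIidPr/subsetP => e; rewrite inE => /andP[]. Qed.

Lemma cutsz_inner B : cutsz (ept I) (edges I) B =
  cutsz (ept I) inner B + cutsz (ept I) (edges I :\: inner) B.
Proof.
by rewrite /cutsz (big_setID inner) /= setI_inner.
Qed.

Lemma net_inner s B : net (ept I) (edges I) s B =
  net (ept I) inner s B + net (ept I) (edges I :\: inner) s B.
Proof.
by rewrite /net (big_setID inner) /= setI_inner.
Qed.

Lemma inside_stubs B : B \subset A ->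
  tot (stubs inside) B = tot (stubs I) B + cutsz (ept I) (edges I :\: inner) B.
Proof.
move=> /subsetP sB; rewrite /tot big_split /=; congr (_ + _).
rewrite exchange_big /=; apply: eq_bigr => e; rewrite !inE => /andP[ni eS].
apply: sum_abs_bnd; move: ni; rewrite eS /= negb_and.
by case/orP=> nA; apply/orP; [left|right]; apply: contra nA => /sB.
Qed.

Lemma inside_load B : B \subset A -> load inside B = load I B.
Proof. by move=> sB; rewrite /load inside_stubs // cutsz_inner /=; lia. Qed.

(** The complement of [A] becomes the root. Its degree is the load of [A], so the root bound is the
    assumption that [A] does not exceed its cut bound; the sum condition is what [s1] achieves on
    [A]. *)
Lemma inside_admissible v1 :
  admissible I v0 -> A \subset verts I ->
  net (ept I) (edges I) s1 A - tot (demand I) A \in dvdz K ->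
  load I A <= K - 2 + rho (tot (target I) A) ->
  (forall B, B != set0 -> B \proper A -> large I B \/
     (tot (target I) B \in dvdz K /\ (tot (target I) A \notin dvdz K \/ B = [set v1]))) ->
  admissible inside v1.
Proof.
move=> adm sA dem root cut; have [ends p1 p2 gap sum _ _] := adm.
split=> /=.
- by move=> e; rewrite inE => /andP[].
- move=> v /(subsetP sA)/p1 pv.
  have : \sum_(e in edges I :\: inner) `|bnd (ept I) e [set v]|
           - net (ept I) (edges I :\: inner) s1 [set v] \in dvdz 2.
    rewrite /net -sumrB; apply: rpred_sum => e _; rewrite /sg; case: (s1 e) => /=; lia.
  move: pv; set x := \sum_(e in _) _; set y := net _ _ _ _; lia.
- move=> v /(subsetP sA)/p2; rewrite cutsz_inner.
  have : cutsz (ept I) (edges I :\: inner) [set v]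
           + net (ept I) (edges I :\: inner) s1 [set v] \in dvdz 2.
    rewrite /net -big_split; apply: rpred_sum => e _ /=; rewrite /sg; case: (s1 e) => /=; lia.
  lia.
- move=> v /(subsetP sA)/gap gv.
  have : `|net (ept I) (edges I :\: inner) s1 [set v]| <=
         \sum_(e in edges I :\: inner) `|bnd (ept I) e [set v]|.
    apply: le_trans (ler_norm_sum _ _ _) _; apply: ler_sum => e _.
    by rewrite /sg; case: (s1 e) => /=; lia.
  set x := \sum_(e in _) _; set z := net _ _ _ _; lia.
- rewrite /tot sumrB -/(tot _ _) sum_net.
  have : net (ept I) inner s1 A = 0.
    by rewrite /net big1 // => e; rewrite inE /bnd => /and3P[_ -> ->]; rewrite subrr mulr0.
  by move: dem; rewrite net_inner => + in0; rewrite in0 add0r -rpredN opprB.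
- by rewrite inside_stubs //; move: root; rewrite /load cutsz_inner;
  rewrite {1}/cutsz big1 ?add0r 1?addrC // => e; rewrite inE /bnd => /and3P[_ -> ->]; rewrite subrr.
move=> B B0 pB; have [lB|[zB ex]] := cut B B0 pB.
  by left; rewrite /large inside_load // proper_sub.
by right; split=> //; case: ex => ?; [left; apply/orP; right|right].
Qed.

End Inside.

(** The quotient is smaller because [A] has two vertices, the inside because [A] is proper. The
    hypothesis on the sets [B] is the cut condition inside [A], where the new root is exempting if
    [A] has nonzero residue. *)
Lemma contract I v0 A v1 : admissible I v0 -> A \proper verts I -> (1 < #|A|)%N ->
  load I A <= K - 2 + rho (tot (target I) A) ->
  (forall B, B != set0 -> B \proper A -> large I B \/
     (tot (target I) B \in dvdz K /\ (tot (target I) A \notin dvdz K \/ B = [set v1]))) ->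
  (forall I' v', admissible I' v' -> (#|verts I'| < #|verts I|)%N -> solvable I') ->
  solvable I.
Proof.
move=> adm pA cA root cut IH; have sA := proper_sub pA.
have [a aA] : exists a, a \in A by apply/set0Pn; rewrite -card_gt0 ltnW.
pose p v := if v \in A then a else v.
have pXa : a \in verts I := subsetP sA _ aA.
have lt1 : (#|verts (quotient I p)| < #|verts I|)%N.
  rewrite ltn_neqAle leq_imset_card andbT; apply/negP => /imset_injP inj.
  have : (#|A| <= 1)%N.
    rewrite (cardsD1 a) aA; rewrite ltnS leqn0 cards_eq0; apply/eqP/setP=> v.
    rewrite !inE; apply/negP => /andP[/eqP va vA]; apply: va; apply: inj => //.
      exact: (subsetP sA).
    by rewrite /p aA vA.
  by rewrite leqNgt cA.
have [s1 Hs1] := IH _ _ (quotient_admissible p adm) lt1.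
have net1 u : net (ept (quotient I p)) (edges (quotient I p)) s1 [set u]
   = net (ept I) (edges I) s1 (pull I p [set u]).
  by apply: eq_bigr => e eS; rewrite (quotient_bnd p adm).
have pullA : pull I p [set a] = A.
  apply/setP=> v; rewrite !inE /p; case: ifP => [vA|nA].
    by rewrite eqxx andbT (subsetP sA).
  by case: eqP => [va|]; [rewrite va aA in nA|rewrite andbF].
have pull1 v : v \in verts I -> v \notin A -> pull I p [set v] = [set v].
  move=> vX nA; apply/setP=> w; rewrite !inE /p; case: ifP => [wA|nwA].
    have /negPf -> : a != v by apply: contra nA => /eqP <-.
    have /negPf -> : w != v by apply: contra nA => /eqP <-.
    by rewrite andbF.
  by case: eqP => [->|]; rewrite ?vX ?andbF.
(* The condition at the contracted vertex [a] concerns all of [A] at once; it becomes the sum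
   condition of the inner instance. *)
have demA : net (ept I) (edges I) s1 A - tot (demand I) A \in dvdz K.
  have := Hs1 a; rewrite net1 /= push_tot pullA; apply.
  by apply/imsetP; exists a; rewrite /p ?aA.
have adm2 := inside_admissible adm sA demA root cut.
have [s2 Hs2] := IH _ _ adm2 (proper_card pA).
pose s e := if e \in edges (inside I A s1) then s2 e else s1 e.
exists s => v vX; case: (boolP (v \in A)) => vA.
  have := Hs2 v vA => /=.
  set inner := [set e in _ | _]; rewrite (net_inner I A) -/inner.
  have -> : net (ept I) inner s [set v] = net (ept I) inner s2 [set v].
    by apply: eq_net => // e eS; rewrite /s /= eS.
  have -> : net (ept I) (edges I :\: inner) s [set v] = net (ept I) (edges I :\: inner) s1 [set v].
    by apply: eq_net => // e; rewrite inE /s /= => /andP[/negPf ->].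
  by rewrite opprB addrA.
have := Hs1 v; rewrite net1 /= push_tot pull1 // /tot big_set1.
have -> : net (ept I) (edges I) s [set v] = net (ept I) (edges I) s1 [set v].
  apply: eq_bigr => e eS; rewrite /s /= inE eS /=; case: ifP => //= /andP[e1 e2].
  rewrite /bnd !inE.
  have /negPf -> : (ept I e).1 != v by apply: contra vA => /eqP <-.
  have /negPf -> : (ept I e).2 != v by apply: contra vA => /eqP <-.
  by rewrite subrr !mulr0.
by apply; apply/imsetP; exists v; rewrite // /p (negPf vA).
Qed.

(** * Reductions by splitting off and deletion *)

Definition smaller_edges_solvable I := forall I' v', admissible I' v' ->
  verts I' = verts I -> (#|edges I'| < #|edges I|)%N -> solvable I'.

(** The situation in which no critical set can be contracted at once; the surplus 2 pays for one
    splitting. *)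
Definition slack_or_exempt I := forall A, A \proper verts I -> (1 < #|A|)%N ->
  K + rho (tot (target I) A) <= load I A \/ (tot (target I) A \in dvdz K /\ exempting I).

Lemma dvdz_eq (m x y : int) : x = y -> x \in dvdz m -> y \in dvdz m.
Proof. by move=> ->. Qed.

Lemma card1_or A : A != set0 -> (exists u, A = [set u]) \/ (1 < #|A|)%N.
Proof.
rewrite -card_gt0 => A0; have [A1|A1] := leqP #|A| 1; last by right.
by left; apply/cards1P; rewrite eqn_leq A1.
Qed.

Lemma tot_set1 f v : tot f [set v] = f v.
Proof. exact: big_set1. Qed.

Definition add_at f x n := fun v => f v + n * (x == v)%:Z.

Lemma tot_add_at f x n A : tot (add_at f x n) A = tot f A + n * (x \in A)%:Z.
Proof. by rewrite /tot /add_at big_split /= -big_distrr /= sum_indic. Qed.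

Lemma split_even (a b c : bool) (r g : int) :
  `|a%:Z - c%:Z| + `|b%:Z - c%:Z| + r + g \in dvdz 2 -> `|a%:Z - b%:Z| + r + g \in dvdz 2.
Proof. by case: a; case: b; case: c => /=; lia. Qed.

Lemma split_drop (a b c : bool) :
  `|a%:Z - c%:Z| + `|b%:Z - c%:Z| <= `|a%:Z - b%:Z| + 2 :> int.
Proof. by case: a; case: b; case: c. Qed.

(** The degree of [v] may fall below its bound, as [v] is exceptional with residue 0. Other single
    vertices keep their degrees because [x] and [y] differ, and a larger set loses at most 2. *)
Lemma split_pair I v x y e1 e2 : admissible I v -> slack_or_exempt I ->
  v \in verts I -> x \in verts I -> y \in verts I ->
  x != v -> y != v -> x != y -> e1 \in edges I -> e2 \in edges I -> e1 != e2 ->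
  joins (ept I) e1 x v -> joins (ept I) e2 y v ->
  target I v \in dvdz K ->
  smaller_edges_solvable I -> solvable I.
Proof.
move=> adm sl vX xX yX xv yv xy e1S e2S e12 j1 j2 tv IH.
have [ends p1 p2 gap sum root cut] := adm.
have [r r0 cr] := cutsz_redirect e1S e2S e12 j1 j2.
pose I' := Inst (verts I) (edges I :\ e2) (redirect (ept I) e1 (x, y))
  (target I) (demand I) (stubs I).
have [||s Hs] := IH I' v _ (erefl _); last first.
- have [s' Es'] := split_net s e1S e2S e12 j1 j2.
  by exists s' => u uX; rewrite Es'; apply: Hs.
- by rewrite /= [X in (_ < X)%N](cardsD1 e2) e2S.
split=> //=.
- move=> e; rewrite !inE /redirect => /andP[_ eS].
  by case: eqP => _ /=; [rewrite xX yX | exact: ends].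
- by move=> u /p2; have [-> ->] := cr [set u]; apply: split_even.
move=> A A0 pA; have [[u Au]|cA] := card1_or A0.
  rewrite {}Au in A0 pA *.
  have [->|uv] := eqVneq u v.
    by right; rewrite tot_set1; split=> //; right.
  have [lA|[zA ex]] := cut _ A0 pA; last first.
    by right; split.
  left; move: lA; rewrite /large /load /=; have [-> ->] := cr [set u].
  rewrite !inE (eq_sym v) (negPf uv) /=.
  have : `|(x == u)%:Z - (y == u)%:Z| = `|(x == u)%:Z - 0| + `|(y == u)%:Z - 0| :> int.
    by case: eqP => [<-|_]; rewrite 1?eq_sym ?(negPf xy) //; case: eqP.
  by move=> ->.
have [lA|[zA fr]] := sl _ pA cA; last by right; split=> //; left.
left; move: lA; rewrite /large /load /=; have [-> ->] := cr A.
by have := split_drop (x \in A) (y \in A) (v \in A); clear; lia.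
Qed.

(** A path between the root and [x] through [v] is replaced by a root edge at [x]. If [d] holds, the
    root edge used enters [v] and [e] leaves it; otherwise both are reversed. The strict inequality
    provides a root edge of that direction. *)
Lemma split_root I v x e d : admissible I v -> slack_or_exempt I ->
  v \in verts I -> x \in verts I -> x != v ->
  e \in edges I -> joins (ept I) e x v ->
  target I v \in dvdz K -> - stubs I v < sg d * (demand I v - target I v) ->
  smaller_edges_solvable I -> solvable I.
Proof.
move=> adm sl vX xX xv eS je tv dv IH.
have [ends p1 p2 gap sum root cut] := adm.
pose I' := Inst (verts I) (edges I :\ e) (ept I) (target I)
  (add_at (add_at (demand I) v (- sg d)) x (sg d)) (add_at (add_at (stubs I) v (-1)) x 1).
have cr A := cutsz_joins A eS je.
have tot_stubs A : tot (stubs I') A = tot (stubs I) A - (v \in A)%:Z + (x \in A)%:Z.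
  by rewrite !tot_add_at; clear; lia.
have [||s Hs] := IH I' v _ (erefl _); last first.
- have [s' Es'] := resign_net s (~~ d) eS je.
  exists s' => u uX; rewrite Es'; move: (Hs u uX); apply: dvdz_eq.
  by rewrite /= /add_at /sg !inE; case: (d) => /=; clear; lia.
- by rewrite /= [X in (_ < X)%N](cardsD1 e) eS.
have Ex := negbTE xv.
split.
- by move=> f; rewrite !inE => /andP[_ /ends].
- move=> u /p1; rewrite /= /add_at /sg; case: (d); case: eqP; case: eqP => /=; clear; lia.
- move=> u /p2; rewrite cr !inE /= /add_at /sg.
  by case: (d); case: (x =P u); case: (v =P u) => /=; clear; lia.
- move=> u uX; have := gap u uX; have := p1 u uX; rewrite /= /add_at.
  case: (v =P u) => [<-|_]; rewrite ?Ex /=.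
    by move: dv; rewrite /sg; case: (d) => /=; clear; lia.
  by rewrite /sg; case: (d); case: eqP => _ /=; clear; lia.
- by rewrite /= !tot_add_at vX xX; move: sum; apply: dvdz_eq; clear; lia.
- by rewrite tot_stubs /= vX xX subrK.
move=> A A0 pA.
have fr : exempting I' = exempting I by rewrite /exempting tot_stubs /= vX xX subrK.
rewrite fr /=; have [[u Au]|cA] := card1_or A0.
  rewrite {}Au in A0 pA *.
  have [->|uv] := eqVneq u v.
    by right; rewrite tot_set1; split=> //; right.
  have [lA|[zA ex]] := cut _ A0 pA; last by right.
  left; move: lA; rewrite /large /load tot_stubs /= cr.
  by rewrite !inE (eq_sym v) (negPf uv); case: (x =P u) => /=; clear; lia.
have [lA|[zA fI]] := sl _ pA cA; last by right; split=> //; left.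
left; move: lA; rewrite /large /load tot_stubs /= cr.
by case: (x \in A); case: (v \in A) => /=; clear; lia.
Qed.

(* Orients e from x to y after adding j root edges at y. *)
Lemma delete_edge I v0 x y e j : admissible I v0 ->
  (forall A, A != set0 -> A \proper verts I -> large I A) ->
  (forall A, A \proper verts I -> (1 < #|A|)%N ->
     K + rho (tot (target I) A) <= load I A) ->
  x \in verts I -> y \in verts I -> x != y ->
  e \in edges I -> joins (ept I) e x y -> pos k (target I x) ->
  0 <= j -> rho (target I y + 1 + j) <= rho (target I y) - 1 + j ->
  tot (stubs I) (verts I) + j <= K - 2 + rho (tot (target I) (verts I) + j) ->
  smaller_edges_solvable I -> solvable I.
Proof.
move=> adm al sl xX yX xy eS je px j0 rj rootj IH.
have [ends p1 p2 gap sum root _] := adm.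
pose I' := Inst (verts I) (edges I :\ e) (ept I)
  (add_at (add_at (target I) x (-1)) y (1 + j))
  (add_at (add_at (demand I) x (-1)) y 1) (add_at (stubs I) y j).
have cr A := cutsz_joins A eS je.
have [||s Hs] := IH I' v0 _ (erefl _); last first.
- have [s' Es'] := resign_net s true eS je.
  exists s' => u uX; rewrite Es'; move: (Hs u uX); apply: dvdz_eq.
  by rewrite /= /add_at /sg !inE; clear; lia.
- by rewrite /= [X in (_ < X)%N](cardsD1 e) eS.
split.
- by move=> f; rewrite !inE => /andP[_ /ends].
- by move=> u /p1; rewrite /= /add_at; case: eqP; case: eqP => /=; clear; lia.
- move=> u /p2; rewrite cr !inE /= /add_at.
  by case: (x =P u); case: (y =P u) => /=; clear; lia.
- move=> u uX; have := gap u uX; rewrite /= /add_at; move: j0.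
  by case: (y =P u) => _; case: (x =P u) => _ /=; clear; lia.
- by rewrite /= !tot_add_at xX yX; move: sum; apply: dvdz_eq; clear; lia.
- by rewrite /= !tot_add_at xX yX;
  by rewrite (_ : _ + _ * _ + _ = tot (target I) (verts I) + j) ?mulr1 //; clear; lia.
move=> A A0 pA; left; have [[u Au]|cA] := card1_or A0.
  rewrite {}Au in A0 pA *.
  have := al _ A0 pA; rewrite /large /load /= !tot_add_at cr !inE !tot_set1.
  have [<-|xu] := eqVneq x u.
    rewrite eq_sym (negPf xy) /= mulr0 mulr1 !addr0; move/eqP: px => ->; clear; lia.
  have [<-|yu] := eqVneq y u; last by rewrite /= !mulr0 !addr0; clear; lia.
  rewrite /= mulr0 !mulr1 addr0 (addrA (target I y)); move: rj; clear.
  by set a := rho (_ + j); set b := rho _; lia.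
(* The worst case is a set containing [y] but not [x]: the load changes by [j - 1] and [rho] by at
   most [j + 1], which uses up the surplus 2. *)
have := sl _ pA cA; rewrite /large /load /= !tot_add_at cr.
set T := tot (target I) A => H.
have := rho_lip (ltnW k_gt1) (T + -1 * (x \in A)%:Z + (1 + j) * (y \in A)%:Z) T.
set a := rho (T + _ + _); move: H j0; set b := rho T.
by case: (x \in A); case: (y \in A) => /=; clear; lia.
Qed.

Definition smaller_stubs_solvable I := forall I' v', admissible I' v' ->
  verts I' = verts I -> edges I' = edges I ->
  tot (stubs I') (verts I) < tot (stubs I) (verts I) -> solvable I'.

(** The deleted root edge leaves [x] if [d] holds and enters it otherwise; the strict inequality
    provides one. Load and bound of [x] both fall by 1. *)
Lemma delete_stub I v0 x d : admissible I v0 ->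
  (forall A, A != set0 -> A \proper verts I -> large I A) ->
  (forall A, A \proper verts I -> (1 < #|A|)%N ->
     K + rho (tot (target I) A) <= load I A) ->
  x \in verts I -> rho (target I x - sg d) = rho (target I x) - 1 ->
  sg d * (demand I x - target I x) < stubs I x ->
  smaller_stubs_solvable I -> solvable I.
Proof.
move=> adm al sl xX rd dx IH.
have [ends p1 p2 gap sum root _] := adm.
pose I' := Inst (verts I) (edges I) (ept I) (add_at (target I) x (- sg d))
  (demand I) (add_at (stubs I) x (-1)).
apply: (IH I' v0) => //; last by rewrite /= tot_add_at xX; clear; lia.
split=> //.
- by move=> u /p1; rewrite /= /add_at /sg; case: (d); case: eqP => /=; clear; lia.
- move=> u uX; have := gap u uX; have := p1 u uX; rewrite /= /add_at.
  case: (x =P u) => [<-|_] /=; last by clear; lia.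
  by move: dx; rewrite /sg; case: (d) => /=; clear; lia.
- move: root; rewrite /= !tot_add_at xX.
  set T := tot (target I) _; have := rho_lip (ltnW k_gt1) T (T + - sg d * true%:Z).
  set a := rho (T + _); set b := rho T.
  by rewrite /sg; case: (d) => /=; clear; lia.
move=> A A0 pA; left; have [[u Au]|cA] := card1_or A0.
  rewrite {}Au in A0 pA *.
  have := al _ A0 pA; rewrite /large /load /= !tot_add_at !inE !tot_set1.
  have [<-|xu] := eqVneq x u; last by rewrite /= !mulr0 !addr0; clear; lia.
  by rewrite /= !mulr1 rd; clear; lia.
have := sl _ pA cA; rewrite /large /load /= !tot_add_at.
set T := tot (target I) A => H.
have := rho_lip (ltnW k_gt1) (T + - sg d * (x \in A)%:Z) T.
set a := rho (T + _); move: H; set b := rho T; rewrite /sg.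
by case: (d); case: (x \in A) => /=; clear; lia.
Qed.

Definition smaller_verts_solvable I := forall I' v', admissible I' v' ->
  (#|verts I'| < #|verts I|)%N -> solvable I'.

Lemma tot_setD1 f v A : v \in A -> tot f A = f v + tot f (A :\ v).
Proof. by move=> vA; rewrite /tot (big_setD1 v). Qed.

Lemma net_parity h S s A : net h S s A + cutsz h S A \in dvdz 2.
Proof.
rewrite /net /cutsz -big_split; apply: rpred_sum => e _ /=.
by rewrite /sg; case: (s e) => /=; lia.
Qed.

(** Apart from loops, all edges at [v] go to [x], and their number is even; they can be oriented so
    as to cancel at both ends. *)
Lemma delete_vertex I v x : admissible I v ->
  v \in verts I -> x \in verts I -> x != v ->
  stubs I v = 0 -> target I v \in dvdz K ->
  (forall e, e \in edges I -> ((ept I e).1 == v) || ((ept I e).2 == v) ->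
     ((ept I e).1 \in [set v; x]) && ((ept I e).2 \in [set v; x])) ->
  smaller_verts_solvable I -> solvable I.
Proof.
move=> adm vX xX xv cv tv far IH.
have [ends p1 p2 gap sum root cut] := adm.
have gv : demand I v = target I v by have := gap v vX; rewrite cv; clear; lia.
pose S' := [set e in edges I | ((ept I e).1 != v) && ((ept I e).2 != v)].
pose M := edges I :\: S'.
pose I' := Inst (verts I :\ v) S' (ept I) (target I) (demand I) (stubs I).
have SI : edges I :&: S' = S' by apply/setIidPr/subsetP => e; rewrite inE => /andP[].
have cutE A : cutsz (ept I) (edges I) A = cutsz (ept I) S' A + cutsz (ept I) M A.
  by rewrite /cutsz (big_setID S') SI.
have netE s A : net (ept I) (edges I) s A = net (ept I) S' s A + net (ept I) M s A.
  by rewrite /net (big_setID S') SI.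
have bM e A : e \in M ->
    bnd (ept I) e A = bnd (ept I) e [set v] * ((v \in A)%:Z - (x \in A)%:Z).
  rewrite !inE => /andP[+ eS]; rewrite eS /= -negb_or negbK => /(far e eS).
  rewrite /bnd !inE => /andP[/orP[]/eqP -> /orP[]/eqP ->];
    rewrite ?eqxx ?(negbTE xv); clear; lia.
have netM s A : net (ept I) M s A =
    net (ept I) M s [set v] * ((v \in A)%:Z - (x \in A)%:Z).
  by rewrite /net big_distrl /=; apply: eq_bigr => e eM; rewrite (bM e A) // mulrA.
have cutM A : cutsz (ept I) M A =
    cutsz (ept I) M [set v] * `|(v \in A)%:Z - (x \in A)%:Z|.
  by rewrite /cutsz big_distrl /=; apply: eq_bigr => e eM; rewrite (bM e A) // normrM.
have bS' e : e \in S' -> bnd (ept I) e [set v] = 0.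
  by rewrite /bnd !inE => /and3P[_ /negbTE -> /negbTE ->].
have cutS'v : cutsz (ept I) S' [set v] = 0.
  by rewrite /cutsz big1 // => e /bS' ->.
have evenM : cutsz (ept I) M [set v] \in dvdz 2.
  have := p2 v vX; rewrite cutE cutS'v gv add0r.
  have : target I v \in dvdz 2.
    by move: tv => /dvdzP[q ->]; clear; lia.
  by set a := cutsz _ _ _; clear; lia.
have adm' : admissible I' v.
  split=> /=.
  - move=> e; rewrite !inE => /and3P[eS n1 n2].
    by rewrite n1 n2 (ends e eS).
  - by move=> u; rewrite inE => /andP[_ /p1].
  - move=> u; rewrite !inE => /andP[uv /p2]; rewrite cutE (cutM [set u]) !inE.
    rewrite (eq_sym v) (negbTE uv); move: evenM.
    by set a := cutsz _ M _; case: (x == u) => /=; clear; lia.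
  - by move=> u; rewrite inE => /andP[_ /gap].
  - by move: sum; rewrite (tot_setD1 _ vX) gv rpredDl.
  - move: root; rewrite !(tot_setD1 _ vX) cv add0r.
    rewrite (rho_mod (ltnW k_gt1) (n := tot (target I) (verts I :\ v))) //.
    by rewrite addrK.
  have fr : exempting I' = exempting I.
    by rewrite /exempting /= !(tot_setD1 _ vX) cv add0r rpredDl.
  move=> A A0 pA; rewrite fr.
  have vA : v \notin A by apply/negP => /(subsetP (proper_sub pA)); rewrite !inE eqxx.
  have sA : A \subset verts I :\ v := proper_sub pA.
  have [xA|nxA] := boolP (x \in A); last first.
    have pA' : A \proper verts I.
      by apply: proper_sub_trans pA _; apply: subsetDl.
    have [|] := cut A A0 pA'; last by right.
    rewrite /large /load /= cutE (cutM A) (negbTE vA) (negbTE nxA).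
    by rewrite subrr normr0 mulr0 addr0; left.
  (* For a set containing [x], the bound comes from the set with [v] added: the edges between [v]
     and [x] then cross neither cut. *)
  have pA' : v |: A \proper verts I.
    move/properP: pA => [_ [u]]; rewrite !inE => /andP[uv uX] uA.
    apply/properP; split; last by exists u; rewrite // !inE negb_or uv.
    by rewrite subUset sub1set vX (subset_trans sA) // subsetDl.
  have totU f : tot f (v |: A) = f v + tot f A.
    by rewrite (@tot_setD1 _ v) ?setU11 // setU1K.
  have [||[zA ex]] := cut (v |: A) _ pA'.
  - by apply/set0Pn; exists v; rewrite setU11.
  - rewrite /large /load cutE (cutM (v |: A)) !totU cv add0r !inE eqxx xA orbT.
    rewrite subrr normr0 mulr0 addr0.
    rewrite (rho_mod (ltnW k_gt1) (n := tot (target I) A)) ?addrK // => lA.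
    left; rewrite /=; suff -> : cutsz (ept I) S' A = cutsz (ept I) S' (v |: A) by [].
    apply: eq_bigr => e; rewrite /bnd !inE => /and3P[_ /negbTE -> /negbTE ->].
    by [].
  right; split; first by move: zA; rewrite totU rpredDl.
  case: ex => [|AE]; first by left.
  have : x \in v |: A by rewrite !inE xA orbT.
  by rewrite AE inE (negbTE xv).
have [|s1 Hs1] := IH _ _ adm'.
  by rewrite /= [X in (_ < X)%N](cardsD1 v) vX.
have [s2 Hs2] := balanced_orientation (ept I) M.
(* At [v] the net out-degree is even and at most 1 in absolute value. *)
have net0 A : net (ept I) M s2 A = 0.
  rewrite netM; have := net_parity (ept I) M s2 [set v].
  have := Hs2 v; move: evenM; set a := cutsz _ _ _; set b := net _ _ _ _.
  move=> e1 e2 e3; have -> : b = 0 by move: e1 e2 e3; clear; lia.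
  by rewrite mul0r.
exists (fun e => if e \in S' then s1 e else s2 e) => u uX.
rewrite netE.
rewrite (@eq_net _ _ _ (ept I) S' _ s1) => [||e ->] //.
rewrite (@eq_net _ _ _ (ept I) M _ s2) => [||e] //; last by rewrite inE => /andP[/negbTE ->].
rewrite net0 addr0; have [->|uv] := eqVneq u v.
  by rewrite /net big1 ?sub0r ?rpredN ?gv // => e /bS' ->; rewrite mulr0.
by apply: Hs1; rewrite /= !inE uv.
Qed.

Lemma joins_sym h e x y : joins h e x y = joins h e y x.
Proof. exact: orbC. Qed.

Lemma joins_verts I v0 e x y : admissible I v0 -> e \in edges I ->
  joins (ept I) e x y -> (x \in verts I) /\ (y \in verts I).
Proof.
by move=> adm /(adm_ends adm)/andP[] + + /orP[]/eqP E1; rewrite E1.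
Qed.

Lemma stubs_ge0 I v0 A : admissible I v0 -> A \subset verts I -> 0 <= tot (stubs I) A.
Proof.
move=> adm /subsetP sA; apply: sumr_ge0 => v /sA vX.
exact: le_trans (adm_gap adm vX).
Qed.

Lemma tot_compl I f A : A \subset verts I ->
  tot f (verts I) = tot f A + tot f (verts I :\: A).
Proof. by move=> sA; rewrite /tot (big_setID A) /= (setIidPr sA). Qed.

Lemma cutsz_compl I v0 A : admissible I v0 -> A \subset verts I ->
  cutsz (ept I) (edges I) (verts I :\: A) = cutsz (ept I) (edges I) A.
Proof.
move=> adm sA; apply: eq_bigr => e /(adm_ends adm)/andP[e1 e2].
by rewrite /bnd !inE e1 e2 !andbT; case: (_ \in A); case: (_ \in A).
Qed.

(** Root edges at [v] are split off first, then pairs of edges to two different neighbours. When at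
    most one neighbour and no root edge remain, [v] is deleted. *)
Lemma eliminate_zero I v : admissible I v -> slack_or_exempt I ->
  v \in verts I -> (1 < #|verts I|)%N -> target I v \in dvdz K ->
  smaller_verts_solvable I -> smaller_edges_solvable I -> solvable I.
Proof.
move=> adm sl vX cX tv IHV IHE.
have gapv := adm_gap adm vX.
have [/exists_inP[e eS /existsP[x /andP[xv je]]]|no1] :=
  boolP [exists e in edges I, exists x, (x != v) && joins (ept I) e x v]; last first.
  have no1' e x : e \in edges I -> joins (ept I) e x v -> x = v.
    move=> eS je; apply/eqP/negPn/negP => xv; case/negP: no1.
    by apply/exists_inP; exists e => //; apply/existsP; exists x; rewrite xv.
  have far0 e : e \in edges I -> ((ept I e).1 == v) || ((ept I e).2 == v) ->
      ept I e = (v, v).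
    move=> eS /joins_ends[x je]; have xv := no1' _ _ eS je.
    by move: je; rewrite xv /joins orbb => /eqP.
  have [cv|cv] := eqVneq (stubs I v) 0.
    have [x xX xv] : exists2 x, x \in verts I & x != v.
      have : (0 < #|verts I :\ v|)%N by move: cX; rewrite (cardsD1 v) vX.
      by rewrite card_gt0 => /set0Pn[x]; rewrite !inE => /andP[]; exists x.
    apply: (delete_vertex adm vX xX xv cv tv) => // e eS ev.
    by rewrite (far0 e eS ev) !inE eqxx.
  have c0 : 0 < stubs I v by move: cv gapv; clear; lia.
  have sv : [set v] \subset verts I by rewrite sub1set.
  have cut0 : cutsz (ept I) (edges I) (verts I :\: [set v]) = 0.
    rewrite (cutsz_compl adm sv) /cutsz big1 // => e eS; rewrite /bnd !inE.
    case: (boolP (((ept I e).1 == v) || ((ept I e).2 == v))) => [/(far0 e eS)->|].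
      by rewrite eqxx.
    by rewrite negb_or => /andP[/negbTE -> /negbTE ->].
  have root := adm_root adm.
  have tX : tot (target I) (verts I) = target I v + tot (target I) (verts I :\: [set v]).
    by rewrite (tot_compl _ sv) tot_set1.
  have cE : tot (stubs I) (verts I) = stubs I v + tot (stubs I) (verts I :\: [set v]).
    by rewrite (tot_compl _ sv) tot_set1.
  have cX0 := stubs_ge0 adm (subsetDl (verts I) [set v]).
  (* Here [v] has root edges but no neighbour. The remaining vertices then have load below the root
     degree, hence below their bound, and they are not exempt: a contradiction. *)
  have [||lA|[zA [/orP[fr|fr]|AE]]] := adm_cut adm (A := verts I :\: [set v]).
  - by rewrite -card_gt0; move: cX; rewrite (cardsD1 v) vX.
  - by apply/properP; split; [exact: subsetDl | exists v; rewrite // !inE eqxx].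
  - move: lA root; rewrite /large /load cut0 cE.
    rewrite (rho_mod (ltnW k_gt1) (m := tot (target I) (verts I))
       (n := tot (target I) (verts I :\: [set v]))); last by rewrite tX addrK.
    by move: c0; clear; lia.
  - by move: fr c0 cX0; rewrite cE; clear; lia.
  - by move: fr; rewrite tX rpredDl // zA.
  - by have := set11 v; rewrite -AE !inE eqxx.
have [xX _] := joins_verts adm eS je.
have [cv|cv] := eqVneq (stubs I v) 0; last first.
  have c0 : 0 < stubs I v by move: cv gapv; clear; lia.
  (* Either some root edge enters [v], or all of them leave it. *)
  have [lt|ge] : - stubs I v < demand I v - target I v \/
                 demand I v - target I v <= - stubs I v.
    by clear; lia.
    by apply: (split_root (d := true) adm sl vX xX xv eS je); rewrite // mul1r.
  apply: (split_root (d := false) adm sl vX xX xv eS je) => //=.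
  by move: ge c0; rewrite /sg; clear; lia.
have [/exists_inP[e2 e2S /existsP[y /and3P[yv yx je2]]]|no2] :=
  boolP [exists e2 in edges I, exists y, [&& y != v, y != x & joins (ept I) e2 y v]].
  have [yX _] := joins_verts adm e2S je2.
  have e12 : e != e2.
    apply: contraNneq yx => E12; move: je je2; rewrite -E12 /joins.
    by move=> /orP[]/eqP -> /orP[]/eqP[]; move=> *; subst; rewrite ?eqxx // in xv yv *.
  by apply: (split_pair adm sl vX xX yX xv yv _ eS e2S e12 je je2); rewrite // eq_sym.
apply: (delete_vertex adm vX xX xv cv tv) => // e2 e2S e2v.
have [y je2] := joins_ends e2v.
have yvx : (y == v) || (y == x).
  apply: contraNT no2; rewrite negb_or => /andP[yv yx].
  by apply/exists_inP; exists e2 => //; apply/existsP; exists y; rewrite yv yx.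
by case/orP: je2 => /eqP ->; rewrite !inE eqxx yvx.
Qed.

(** Without such an edge, the loads of [A] and of its complement would consist of root edges only.
    Adding their bounds and applying [rhoD] contradicts the root bound, as [2k - 2] is positive. *)
Lemma cut_gt0 I v0 A : admissible I v0 ->
  (forall A, A != set0 -> A \proper verts I -> large I A) ->
  A != set0 -> A \proper verts I ->
  exists e x y, [/\ e \in edges I, joins (ept I) e x y, x \in A & y \notin A].
Proof.
move=> adm al A0 pA; have sA := proper_sub pA.
have B0 : verts I :\: A != set0.
  by rewrite setD_eq0; move: pA; rewrite properE => /andP[].
have pB : verts I :\: A \proper verts I.
  have /set0Pn[a aA] := A0; apply/properP; split; first exact: subsetDl.
  by exists a; [exact: (subsetP sA) | rewrite !inE aA].
have cut_ne0 : cutsz (ept I) (edges I) A != 0.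
  apply/eqP => c0; have := al _ A0 pA; have := al _ B0 pB; have := adm_root adm.
  rewrite /large /load (cutsz_compl adm sA) c0 !(tot_compl _ sA).
  have := rhoD (ltnW k_gt1) (tot (target I) A) (tot (target I) (verts I :\: A)).
  set a := rho _; set b := rho _; set c := rho _; move: k_gt1; clear; lia.
have [/exists_inP[e eS be]|no] := boolP [exists e in edges I, bnd (ept I) e A != 0].
  move: be; rewrite /bnd; case E1: (ept I e) => [x y] /=.
  case xA: (x \in A); case yA: (y \in A) => //= _.
    by exists e, x, y; rewrite /joins E1 eqxx yA.
  by exists e, y, x; rewrite /joins E1 eqxx orbT xA.
case/negP: cut_ne0; rewrite /cutsz big1 // => e eS.
by apply/eqP; rewrite normr_eq0; apply: contraNT no => be; apply/exists_inP; exists e.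
Qed.

(** [d] is the degree of a root that all its edges leave, and [j] edges entering it are added. The
    first bound forces [d < 2k], since otherwise [rho d <= d - 2k]. *)
Lemma raise_root (d j : int) : 0 <= d -> d <= K - 2 + rho d -> 1 <= j <= k%:Z - 1 ->
  d + j <= K - 2 + rho (j - d).
Proof.
move=> d0 dr jk.
have dK : d <= K - 1.
  have := rho_le_shift (ltnW k_gt1) d (-1); rewrite mulrN1.
  by have := rho_bounds (ltnW k_gt1) d; move: dr d0; clear; lia.
have [z ->] := rho_attained (ltnW k_gt1) (j - d).
have [z1|[z0|z2]] : z <= -1 \/ z = 0 \/ 1 <= z by clear; lia.
- have : K * z <= - K by move: k_gt1 z1; clear; nia.
  by move: dK d0 jk; clear; lia.
- by rewrite z0 mulr0 addr0; move: dK d0 jk; clear; lia.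
- have : K <= K * z by move: k_gt1 z2; clear; nia.
  by move: dK d0 jk; clear; lia.
Qed.

(* Adding k - rho stubs at y raises its residue to k, which is also negative, so
   that an edge xy can be deleted. *)
Lemma all_positive I v0 : admissible I v0 -> (1 < #|verts I|)%N ->
  (forall A, A != set0 -> A \proper verts I -> large I A) ->
  (forall A, A \proper verts I -> (1 < #|A|)%N ->
     K + rho (tot (target I) A) <= load I A) ->
  (forall v, v \in verts I -> pos k (target I v) && ~~ neg k (target I v)) ->
  (forall v, v \in verts I -> stubs I v = demand I v - target I v) ->
  smaller_edges_solvable I -> solvable I.
Proof.
move=> adm cX al sl po cE IH.
have [y yX] : exists y, y \in verts I by apply/set0Pn; rewrite -card_gt0 ltnW.
have p1 : [set y] \proper verts I by rewrite properEcard sub1set yX cards1.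
have y0 : [set y] != set0 by apply/set0Pn; exists y; rewrite set11.
have [e [y' [x [eS je /set1P Ey]]]] := cut_gt0 adm al y0 p1; rewrite {y'}Ey in je.
rewrite inE => xy; rewrite joins_sym in je.
have [xX _] := joins_verts adm eS je.
have /andP[py ny] := po y yX; have /andP[px _] := po x xX.
have [jk rj] := pos_raise (ltnW k_gt1) py ny.
have cT : tot (stubs I) (verts I) = tot (demand I) (verts I) - tot (target I) (verts I).
  by rewrite /tot -sumrB; apply: eq_bigr.
have c0 := stubs_ge0 adm (subxx (verts I)).
apply: (delete_edge (j := k%:Z - rho (target I y)) adm al sl xX yX xy eS je px) => //.
- by move: jk; clear; lia.
- rewrite addrAC rj; clear; lia.
have Dg := adm_sum adm; have root := adm_root adm.
(* The demands sum to 0 modulo [2k] and every root edge enters its vertex, so the targets sum to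
   minus the root degree. *)
rewrite (rho_mod (ltnW k_gt1) (m := tot (target I) (verts I) + (k%:Z - rho (target I y)))
  (n := k%:Z - rho (target I y) - tot (stubs I) (verts I))).
  apply: raise_root => //; move: root; congr (_ <= _ + _).
  rewrite -[RHS](rhoN (ltnW k_gt1)); apply: (rho_mod (ltnW k_gt1)).
  by rewrite cT opprK addrC subrK.
by rewrite cT; move: Dg; apply: dvdz_eq; set r := rho _; clear; lia.
Qed.

Definition opposite I := Inst (verts I) (edges I) (ept I)
  (fun v => - target I v) (fun v => - demand I v) (stubs I).

Lemma tot_opp f A : tot (fun v => - f v) A = - tot f A.
Proof. exact: sumrN. Qed.

Lemma opposite_large I A : large (opposite I) A = large I A.
Proof. by rewrite /large /load /= tot_opp rhoN // ltnW. Qed.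

Lemma opposite_admissible I v0 : admissible I v0 -> admissible (opposite I) v0.
Proof.
move=> [ends p1 p2 gap sum root cut]; split=> //=.
- by move=> v /p1; clear; lia.
- by move=> v /p2; set a := cutsz _ _ _; clear; lia.
- by move=> v /gap; clear; lia.
- by rewrite tot_opp rpredN.
- by rewrite tot_opp rhoN // ltnW.
move=> A A0 pA; rewrite opposite_large tot_opp rpredN /exempting /= tot_opp rpredN.
exact: cut.
Qed.

Lemma opposite_solvable I : solvable (opposite I) -> solvable I.
Proof.
move=> [s Hs]; exists (fun e => ~~ s e) => v vX; have := Hs v vX.
rewrite -rpredN /=; apply: dvdz_eq; rewrite opprD opprK; congr (_ - _).
rewrite /net -sumrN; apply: eq_bigr => e _; rewrite /sg; case: (s e) => /=; clear; lia.
Qed.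

Lemma solve_step I v0 : admissible I v0 -> smaller_verts_solvable I ->
  smaller_edges_solvable I -> smaller_stubs_solvable I -> solvable I.
Proof.
move=> adm IHV IHE IHC; have [cX|cX] := leqP #|verts I| 1.
  exists xpredT => v vX; have XE : verts I = [set v].
    by apply/esym/eqP; rewrite eqEcard sub1set vX cards1.
  have := adm_sum adm; rewrite XE tot_set1 => gv.
  rewrite /net big1 ?sub0r ?rpredN // => e /(adm_ends adm)/andP[].
  by rewrite /bnd XE => -> ->.
pose critical A := [&& A \proper verts I, (1 < #|A|)%N
  & load I A <= K - 2 + rho (tot (target I) A)].
(* Violating subsets of such a set [A] stay permitted: if they rely on [I] being exempting, then [A]
   has nonzero residue and the new root is exempting too. *)
have [/existsP[A /andP[/and3P[pA cA lA] nfree]]|none] := boolP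
  [exists A, critical A && ~~ (exempting I && (tot (target I) A \in dvdz K))].
  apply: (contract (v1 := v0) adm pA cA lA) IHV => B B0 pB.
  have [|[zB ex]] := adm_cut adm B0 (proper_trans pB pA); first by left.
  right; split=> //; case: ex => [fr|]; last by right.
  by left; move: nfree; rewrite fr.
have sl : slack_or_exempt I.
  move=> A pA cA; have [lA|gA] := boolP (load I A <= K - 2 + rho (tot (target I) A)).
    right; apply/andP; rewrite andbC; apply: contraNT none => nf.
    by apply/existsP; exists A; rewrite /critical pA cA lA.
  by left; apply: slack adm (proper_sub pA) gA.
have [/exists_inP[v vX tv]|nz] := boolP [exists v in verts I, target I v \in dvdz K].
  (* Unless [v0] is itself a vertex of residue 0, its exception is void and can be transferred to
     [v]. *)
  pose w := if (v0 \in verts I) && (target I v0 \in dvdz K) then v0 else v.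
  have wX : w \in verts I by rewrite /w; case: ifP => // /andP[].
  have tw : target I w \in dvdz K by rewrite /w; case: ifP => // /andP[].
  suff admw : admissible I w by apply: (eliminate_zero admw).
  have [ends p1 p2 gap sum root cut] := adm; split=> // A A0 pA.
  have [|[zA ex]] := cut A A0 pA; [by left | right; split=> //].
  case: ex => [|AE]; [by left | right; rewrite AE /w].
  move: zA pA; rewrite AE tot_set1 => -> /proper_sub; rewrite sub1set => ->.
  by [].
have nz1 v : v \in verts I -> target I v \notin dvdz K.
  by move=> vX; apply: contra nz => tv; apply/exists_inP; exists v.
have large1 v : [set v] \proper verts I -> large I [set v].
  move=> pv; have v0' : [set v] != set0 by rewrite -card_gt0 cards1.
  have [//|[]] := adm_cut adm v0' pv; rewrite tot_set1 => tv.
  by move: (nz1 v); rewrite tv -sub1set (proper_sub pv) => /(_ isT).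
(* Single vertices now satisfy the bound and, by minimality, so do all proper nonempty subsets of
   [A]; hence [A] can be contracted even if its residue is 0. *)
have [/existsP[A0 critA0]|nocrit] := boolP [exists A, critical A].
  have [A critA minA] := arg_minnP (fun A : {set V} => #|A|) critA0.
  have /and3P[pA cA lA] := critA.
  apply: (contract (v1 := v0) adm pA cA lA) IHV => B B0 pB; left.
  have pBX := proper_trans pB pA.
  have [[u Bu]|cB] := card1_or B0; first by rewrite Bu in pBX *; apply: large1.
  rewrite /large; have : ~~ critical B.
    by apply/negP => /minA; rewrite leqNgt proper_card.
  rewrite /critical pBX cB /=; set r := rho _; clear; lia.
have sl' A : A \proper verts I -> (1 < #|A|)%N -> K + rho (tot (target I) A) <= load I A.
  move=> pA cA; apply: slack adm (proper_sub pA) _ => //.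
  by apply: contra nocrit => lA; apply/existsP; exists A; rewrite /critical pA cA.
have al A : A != set0 -> A \proper verts I -> large I A.
  move=> A0 pA; have [[u Au]|cA] := card1_or A0.
    by rewrite Au in pA *; apply: large1.
  by have := sl' A pA cA; rewrite /large; set r := rho _; clear; lia.
have [/existsP[e /existsP[x /existsP[y /and5P[eS xy je px ny]]]]|no4a] := boolP
    [exists e, exists x, exists y, [&& e \in edges I, x != y, joins (ept I) e x y,
       pos k (target I x) & neg k (target I y)]].
  have [xX yX] := joins_verts adm eS je.
  apply: (delete_edge (j := 0) adm al sl' xX yX xy eS je px) => //.
    by move/eqP: ny; rewrite !addr0 => ->.
  by rewrite !addr0; apply: (adm_root adm).
have no4a' e x y : e \in edges I -> x != y -> joins (ept I) e x y ->
    pos k (target I x) -> ~~ neg k (target I y).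
  move=> eS xy je px; apply: contra no4a => ny; apply/existsP; exists e.
  by apply/existsP; exists x; apply/existsP; exists y; rewrite eS xy je px ny.
have [/exists_inP[x xX /andP[px dx]]|no4b] := boolP [exists x in verts I,
    pos k (target I x) && (demand I x - target I x < stubs I x)].
  by apply: (delete_stub (d := true) adm al sl' xX (eqP px)) => //; rewrite mul1r.
have [/exists_inP[x xX /andP[nx dx]]|no4b'] := boolP [exists x in verts I,
    neg k (target I x) && (target I x - demand I x < stubs I x)].
  apply: (delete_stub (d := false) adm al sl' xX _) => //.
    by rewrite opprK; apply/eqP.
  by rewrite /sg mulN1r opprB.
have pn v : v \in verts I -> pos k (target I v) || neg k (target I v).
  by move=> vX; apply: (pos_or_neg (ltnW k_gt1)); apply: nz1.
(* Every cut contains an edge, so a property that no edge separates holds everywhere or nowhere. *)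
have connected (P : pred V) : (forall e x y, e \in edges I -> joins (ept I) e x y ->
     P x -> ~~ P y -> False) ->
    (forall v, v \in verts I -> P v) \/ (forall v, v \in verts I -> ~~ P v).
  move=> noP; have [P0|P0] := eqVneq [set v in verts I | P v] set0.
    right=> v vX; apply/negP => Pv.
    by have := in_set0 v; rewrite -P0 inE vX Pv.
  left=> v vX; apply/negPn/negP => nPv.
  have pP : [set v in verts I | P v] \proper verts I.
    apply/properP; split; first by apply/subsetP => u; rewrite inE => /andP[].
    by exists v; rewrite // inE vX.
  have [e [x [y [eS je + +]]]] := cut_gt0 adm al P0 pP.
  have [_ yX] := joins_verts adm eS je.
  by rewrite !inE yX => /andP[_ Px] nPy; apply: (noP e x y).
have nbr v : v \in verts I -> exists e x, [/\ e \in edges I, joins (ept I) e v x & v != x].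
  move=> vX; have v0' : [set v] != set0 by rewrite -card_gt0 cards1.
  have pv : [set v] \proper verts I by rewrite properEcard sub1set vX cards1.
  have [e [y [x [eS je /set1P Ey]]]] := cut_gt0 adm al v0' pv.
  by rewrite inE eq_sym; exists e, x; split=> //; rewrite -Ey.
have neq_P (P : pred V) x y : P x -> ~~ P y -> x != y.
  by move=> Px; apply: contraNneq => <-.
have [allp|nop] : (forall v, v \in verts I -> pos k (target I v)) \/
    (forall v, v \in verts I -> ~~ pos k (target I v)).
  apply: connected => e x y eS je px npy.
  have [_ yX] := joins_verts adm eS je.
  have := no4a' e x y eS (neq_P (fun v => pos k (target I v)) _ _ px npy) je px.
  by have := pn y yX; rewrite (negbTE npy) /= => ->.
  (* Each vertex has a positive neighbour; if it were negative as well, the edge between them could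
     be deleted. All root edges enter their vertices, for the others could be deleted. *)
  apply: (all_positive adm cX al sl') => // v vX.
    have [e [x [eS je vx]]] := nbr v vX; rewrite allp //=.
    apply: (no4a' e x v) => //; [by rewrite eq_sym | by rewrite joins_sym |].
    by apply: allp; have [] := joins_verts adm eS je.
  have := adm_gap adm vX; have : ~~ (demand I v - target I v < stubs I v).
    by apply: contra no4b => lt; apply/exists_inP; exists v; rewrite ?allp.
  by clear; lia.
have alln v : v \in verts I -> neg k (target I v).
  by move=> vX; have := pn v vX; rewrite (negbTE (nop v vX)).
(* Reversing every edge exchanges [pos] and [neg]. *)
apply: opposite_solvable => //.
apply: (all_positive (opposite_admissible adm) cX) => //.
- by move=> A A0 pA; rewrite opposite_large //; apply: al.
- by move=> A pA cA; rewrite /= tot_opp rhoN ?(ltnW k_gt1) //; apply: sl'.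
- move=> v vX /=; rewrite -negN ?(ltnW k_gt1) // alln //=.
  by rewrite negN ?(ltnW k_gt1) // opprK nop.
move=> v vX /=; have := adm_gap adm vX.
have : ~~ (target I v - demand I v < stubs I v).
  by apply: contra no4b' => lt; apply/exists_inP; exists v; rewrite ?alln.
by clear; lia.
Qed.

(** Lexicographic induction on the numbers of vertices, edges and root edges. Root edges come last
    because the deletion of an edge may add some. *)
Theorem admissible_solvable I v0 : admissible I v0 -> solvable I.
Proof.
have [n] := ubnP #|verts I|; elim: n I v0 => // n IHn I v0.
have [m] := ubnP #|edges I|; elim: m I v0 => // m IHm I v0.
have [l] := ubnP `|tot (stubs I) (verts I)|%N; elim: l I v0 => // l IHl I v0.
move=> ltl ltm ltn adm; apply: (solve_step adm).
- move=> I' v' adm' ltV; apply: IHn adm'.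
  exact: leq_trans ltV (_ : #|verts I| <= n)%N.
- move=> I' v' adm' EV ltE; apply: IHm adm'; last by rewrite EV.
  exact: leq_trans ltE (_ : #|edges I| <= m)%N.
move=> I' v' adm' EV EE ltc; have := stubs_ge0 adm' (subxx _); rewrite EV => c0.
apply: IHl adm'; rewrite ?EV ?EE //.
by move: c0 ltl ltc; clear; lia.
Qed.

End ModularOrientation.

(** * Equitable edge colourings of bipartite graphs *)

Lemma card_set_sum (E : finType) (P : pred E) : #|[set e | P e]| = \sum_e (P e : nat).
Proof. by rewrite -sum1dep_card big_mkcond; apply: eq_bigr => e _; case: (P e). Qed.

Section BalancedSquares.
Local Open Scope ring_scope.

Lemma sum_sqr (a b c d : int) : a + b = c + d ->
  2 * (c ^+ 2 + d ^+ 2 - (a ^+ 2 + b ^+ 2)) = `|c - d| ^+ 2 - `|a - b| ^+ 2.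
Proof.
move=> eqs; rewrite -!normrX !ger0_norm ?sqr_ge0 // [a](_ : _ = c + d - b); last by rewrite -eqs addrK.
by rewrite !expr2; lia.
Qed.

Lemma balanced_squares (a b c d : int) : a + b = c + d -> `|a - b| <= 1 ->
  a ^+ 2 + b ^+ 2 <= c ^+ 2 + d ^+ 2.
Proof.
move=> eqs le1; have := sum_sqr eqs.
have : `|a - b| ^+ 2 <= `|c - d| ^+ 2 by rewrite ler_sqr ?qualifE //=; lia.
move: (a ^+ 2) (b ^+ 2) (c ^+ 2) (d ^+ 2) (`|a - b| ^+ 2) (`|c - d| ^+ 2); clear; lia.
Qed.

Lemma balanced_squares_lt (a b c d : int) : a + b = c + d -> `|a - b| <= 1 ->
  2 <= `|c - d| -> a ^+ 2 + b ^+ 2 < c ^+ 2 + d ^+ 2.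
Proof.
move=> eqs le1 ge2; have := sum_sqr eqs.
have : `|a - b| ^+ 2 < `|c - d| ^+ 2 by rewrite ltr_sqr ?qualifE //=; lia.
move: (a ^+ 2) (b ^+ 2) (c ^+ 2) (d ^+ 2) (`|a - b| ^+ 2) (`|c - d| ^+ 2); clear; lia.
Qed.
End BalancedSquares.

Section Colouring.
Variables (V E : finType) (tl hd : E -> V) (k : nat).
Hypothesis k_gt0 : 0 < k.

(** [inl] gives the out-copy of a vertex and [inr] its in-copy, so a loop becomes an ordinary
    edge. *)
Definition side (e : E) : (V + V) * (V + V) := (inl (tl e), inr (hd e)).
Definition inc (e : E) (w : V + V) : bool := (inl (tl e) == w) || (inr (hd e) == w).
Definition colour_deg (c : E -> 'I_k) (i : 'I_k) w : nat := \sum_e (inc e w && (c e == i)).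
Definition energy (c : E -> 'I_k) : nat := \sum_w \sum_(i < k) colour_deg c i w ^ 2.

Lemma sum_colour_deg c w : \sum_(i < k) colour_deg c i w = \sum_e inc e w.
Proof.
rewrite exchange_big; apply: eq_bigr => e _ /=.
rewrite (bigD1 (c e)) //= eqxx andbT big1 ?addn0 // => i.
by rewrite eq_sym => /negbTE ->; rewrite andbF.
Qed.

(** The edges coloured [i] or [j] get a balanced orientation and are recoloured by direction. As the
    graph is bipartite, the net out-degree at a vertex is, up to sign, the difference of its two
    colour degrees. *)
Lemma rebalance (c : E -> 'I_k) (i j : 'I_k) : i != j -> exists c' : E -> 'I_k,
  [/\ forall w l, l != i -> l != j -> colour_deg c' l w = colour_deg c l w,
      forall w, colour_deg c' i w + colour_deg c' j w = colour_deg c i w + colour_deg c j w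
    & forall w, (`|(colour_deg c' i w)%:Z - (colour_deg c' j w)%:Z| <= 1)%R].
Proof.
move=> ij; pose S := [set e | (c e == i) || (c e == j)].
have [s Hs] := balanced_orientation side S.
pose c' e := if e \in S then (if s e then i else j) else c e.
have ji : (j == i) = false by rewrite eq_sym (negbTE ij).
exists c'; split.
- move=> w l li lj; apply: eq_bigr => e _; rewrite /c' inE.
  case: ifP => // /orP[]/eqP ->; case: (s e);
    by rewrite 1?(eq_sym i) 1?(eq_sym j) 1?(eq_sym i) 1?(eq_sym j) ?(negbTE li) ?(negbTE lj).
- move=> w; rewrite /colour_deg -!big_split; apply: eq_bigr => e _ /=; rewrite /c' inE.
  case: ifP => // /orP[]/eqP ->; case: (s e);
    by rewrite ?eqxx ?(negbTE ij) ?ji ?andbT ?andbF ?addn0 ?add0n.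
move=> w; have := Hs w; congr (_ <= _)%R.
have E1 : ((colour_deg c' i w)%:Z - (colour_deg c' j w)%:Z =
    \sum_(e in S) sg (s e) * (inc e w)%:Z)%R.
  rewrite /colour_deg !(big_morph Posz PoszD (erefl _)) -sumrB [RHS]big_mkcond /=.
  apply: eq_bigr => e _; rewrite /c'; case: ifP => [_|]; last first.
    by rewrite inE => /negbT; rewrite negb_or => /andP[/negbTE -> /negbTE ->]; rewrite andbF.
  by case: (s e); rewrite ?eqxx ?(negbTE ij) ?ji ?andbT ?andbF /sg; case: (inc e w).
rewrite E1 /net; case: w {E1} => v.
  congr (`|_|)%R; apply: eq_bigr => e _; rewrite /bnd /inc /side !inE /=.
  by rewrite orbF subr0.
rewrite -normrN -sumrN; congr (`|_|)%R; apply: eq_bigr => e _.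
by rewrite /bnd /inc /side !inE /= sub0r mulrN opprK.
Qed.

Lemma equitable_colouring :
  (forall v, k %| #|[set e | tl e == v]|) -> (forall v, k %| #|[set e | hd e == v]|) ->
  exists c : E -> 'I_k, forall i v,
    #|[set e | (tl e == v) && (c e == i)]| = #|[set e | tl e == v]| %/ k /\
    #|[set e | (hd e == v) && (c e == i)]| = #|[set e | hd e == v]| %/ k.
Proof.
move=> dtl dhd.
have dw w : k %| \sum_e inc e w.
  case: w => v; [move: (dtl v)|move: (dhd v)]; rewrite card_set_sum;
    congr (_ %| _); apply: eq_bigr => e _; rewrite /inc //=.
  by rewrite orbF.
pose c0 : {ffun E -> 'I_k} := [ffun => Ordinal k_gt0].
have [c _ minc] := arg_minnP (fun c : {ffun E -> 'I_k} => energy c) (isT : xpredT c0).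
suff eqd i w : colour_deg c i w = (\sum_e inc e w) %/ k.
  exists c => i v; split; [have := eqd i (inl v) | have := eqd i (inr v)];
    rewrite !card_set_sum /colour_deg /inc => H.
    by under eq_bigr do rewrite -[tl _ == v]orbF; rewrite H; under eq_bigr do rewrite orbF.
  by [].
(* Rebalancing two colours that differ by at least 2 at [w'] lowers the energy there and raises it
   nowhere, against minimality. *)
have tie a b w' : colour_deg c b w' + 2 <= colour_deg c a w' -> False.
  move=> lt; have ab : a != b by apply: contraTneq lt => ->; rewrite -ltnNge; lia.
  have [c' [C1 C2 C3]] := rebalance c ab.
  have := minc [ffun e => c' e] isT; apply/negP; rewrite -ltnNge.
  have E' l u : colour_deg [ffun e => c' e] l u = colour_deg c' l u.
    by apply: eq_bigr => e _; rewrite ffunE.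
  have split_sq d u : \sum_(l < k) colour_deg d l u ^ 2 =
      colour_deg d a u ^ 2 + colour_deg d b u ^ 2
      + \sum_(l < k | (l != a) && (l != b)) colour_deg d l u ^ 2.
    by rewrite (bigD1 a) //= (bigD1 b) 1?eq_sym //= addnA.
  have rest u : \sum_(l < k | (l != a) && (l != b)) colour_deg [ffun e => c' e] l u ^ 2
     = \sum_(l < k | (l != a) && (l != b)) colour_deg c l u ^ 2.
    by apply: eq_bigr => l /andP[la lb]; rewrite E' C1.
  have le u : \sum_(l < k) colour_deg [ffun e => c' e] l u ^ 2 <= \sum_(l < k) colour_deg c l u ^ 2.
    rewrite !split_sq rest leq_add2r !E'.
    have := C2 u; have := C3 u; move: (colour_deg c' a u) (colour_deg c' b u) => p q.
    move: (colour_deg c a u) (colour_deg c b u) => x y h1 h2.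
    have := @balanced_squares p q x y; lia.
  rewrite /energy (bigD1 w') //= [X in _ < X](bigD1 w') //= -addSn leq_add //; last first.
    by apply: leq_sum => u _; apply: le.
  rewrite !split_sq rest -addSn leq_add2r !E'.
  have := C2 w'; have := C3 w'; move: (colour_deg c' a w') (colour_deg c' b w') => p q.
  move: lt; move: (colour_deg c a w') (colour_deg c b w') => x y h0 h1 h2.
  have := @balanced_squares_lt p q x y; lia.
have [m Em] := dvdnP (dw w); rewrite Em mulnK //; apply/eqP.
(* The average colour degree at [w] is the integer [m], so a colour above [m] and one below it occur
   together and differ by at least 2. *)
have sumE : \sum_(l < k) colour_deg c l w = \sum_(l < k) m.
  by rewrite sum_colour_deg Em sum_nat_const card_ord mulnC.
rewrite eqn_leq; apply/andP; split; rewrite leqNgt; apply/negP => ne.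
  have [/existsP[j lt]|no] := boolP [exists j, colour_deg c j w < m].
    by apply: (tie i j w); lia.
  have : \sum_(l < k) m < \sum_(l < k) colour_deg c l w.
    rewrite (bigD1 i) //= [X in _ < X](bigD1 i) //= -addSn leq_add // leq_sum // => l _.
    by rewrite leqNgt; apply: contra no => lt; apply/existsP; exists l.
  by rewrite sumE ltnn.
have [/existsP[j lt]|no] := boolP [exists j, m < colour_deg c j w].
  by apply: (tie j i w); lia.
have : \sum_(l < k) colour_deg c l w < \sum_(l < k) m.
  rewrite (bigD1 i) //= [X in _ < X](bigD1 i) //= -addSn leq_add // leq_sum // => l _.
  by rewrite leqNgt; apply: contra no => lt; apply/existsP; exists l.
by rewrite sumE ltnn.
Qed.
End Colouring.

(** * Degrees in multigraphs and the final assembly *)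

Section Degrees.
Variables (V : finType).
Implicit Types G : mgraph V.

Lemma deg_sum (G : mgraph V) v : deg G v = \sum_(e : edge G) (((ends e).1 == v) + ((ends e).2 == v) : nat).
Proof. by rewrite /deg !card_set_sum big_split. Qed.

Lemma handshake G : \sum_v deg G v = 2 * #|edge G|.
Proof.
under eq_bigr do rewrite deg_sum; rewrite exchange_big /= -sum1_card big_distrr /=.
apply: eq_bigr => e _; rewrite big_split /= (bigD1 (ends e).1) //= eqxx.
rewrite big1 => [|v /negbTE]; last by rewrite eq_sym => ->.
rewrite (bigD1 (ends e).2) //= eqxx big1 // => v /negbTE.
by rewrite eq_sym => ->.
Qed.

Lemma deg_factor G (S : {set edge G}) v : deg (factor S) v =
  \sum_(e in S) (((ends e).1 == v) + ((ends e).2 == v) : nat).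
Proof. by rewrite deg_sum (big_sub (mem S)). Qed.

Lemma cutsz_cut_size G X : cutsz (@ends V G) [set: edge G] X = (cut_size G X)%:Z%R.
Proof.
rewrite /cutsz /cut_size /cut_edges card_set_sum (big_morph Posz PoszD (erefl _)) big_mkcond /=.
by apply: eq_bigr => e _; rewrite inE /bnd; case: (_ \in X); case: (_ \in X).
Qed.

Lemma cutsz_deg G v : (cutsz (@ends V G) [set: edge G] [set v] + (deg G v)%:Z)%R \in dvdz 2.
Proof.
rewrite deg_sum (big_morph Posz PoszD (erefl _)) /cutsz big_mkcond /= -big_split /=.
apply: rpred_sum => e _; rewrite inE /bnd !inE.
by case: (_ == v); case: (_ == v).
Qed.

Lemma modular_orientation (k : nat) G (Q : {set V}) : 1 < k ->
  k %| #|edge G| -> (forall v, k %| deg G v) ->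
  Q = [set v | odd (deg G v %/ k)] ->
  (forall X : {set V}, odd #|X :&: Q| -> 3 * k - 2 <= cut_size G X) ->
  exists s : edge G -> bool, forall v,
    (net (@ends V G) [set: edge G] s [set v] - k%:Z * (v \in Q)%:Z)%R \in dvdz (2 * k%:Z)%R.
Proof.
move=> k1 dvdE dvdV defQ cutQ; have k0 := ltnW k1.
case: (pickP V) => [v0 _|none]; last by exists xpredT => v; have := none v.
pose t v : int := (k%:Z * (v \in Q)%:Z)%R.
have tot_t A : tot t A = (k%:Z * #|A :&: Q|%:Z)%R.
  rewrite /tot /t -big_distrr /=; congr (_ * _)%R.
  rewrite -sum1_card (big_morph Posz PoszD (erefl _)) [RHS]big_mkcond [LHS]big_mkcond /=.
  by apply: eq_bigr => v _; rewrite inE; case: (v \in A); case: (v \in Q).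
have oddQ v : odd (deg G v %/ k) = (v \in Q) by rewrite defQ inE.
(* The quotients [deg G v %/ k] sum to twice an integer because [k] divides the number of edges;
   hence the residues sum to a multiple of [2k]. *)
have evenQ : ~~ odd #|Q|.
  have : \sum_v (deg G v %/ k) = 2 * (#|edge G| %/ k).
    apply/eqP; rewrite -(eqn_pmul2r k0) -mulnA divnK // -handshake big_distrl /=.
    by apply/eqP/eq_bigr => v _; rewrite divnK.
  have : odd #|Q| = odd (\sum_v (deg G v %/ k)).
    rewrite -sum1_card big_mkcond /=.
    rewrite !(big_morph odd oddD (erefl _)).
    by apply: eq_bigr => v _; rewrite oddQ; case: (v \in Q).
  by move=> -> ->; rewrite mul2n odd_double.
pose I := Inst [set: V] [set: edge G] (@ends V G) t t (fun=> 0%R).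
have stubs0 A : tot (stubs I) A = 0%R by rewrite /tot big1.
have adm : admissible k I v0.
  split=> //=.
  - by move=> e _; rewrite !inE.
  - by move=> v _; move: (t v); clear; lia.
  - move=> v _; have := cutsz_deg G v; have := divnK (dvdV v).
    rewrite /t -oddQ; move: (deg G v %/ k) => d; move: (deg G v) => n <-.
    rewrite -{1}(odd_double_half d) -mul2n PoszM PoszD.
    move: (cutsz _ _ _) (odd d) (half d) => c b m; case: b => /=; clear; lia.
  - by move=> v _; rewrite subrr normr0.
  - rewrite tot_t setTI -(odd_double_half #|Q|) (negbTE evenQ) add0n -mul2n PoszM.
    by rewrite mulrCA mulrA dvdz_mulr.
  - by rewrite stubs0; have := rho_bounds k0 (tot t [set: V]); move: k1; clear; lia.
  (* An odd set has residue [k], and [2k - 2 + k] is the assumed bound. An even set has residue 0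
     and is exempt, since the root is isolated. *)
  move=> A A0 pA; have [oA|eA] := boolP (odd #|A :&: Q|).
    left; rewrite /large /load stubs0 addr0 /= tot_t cutsz_cut_size.
    have -> : (k%:Z * #|A :&: Q|%:Z = (#|A :&: Q|./2)%:Z * (2 * k%:Z) + k%:Z)%R.
      rewrite -{1}(odd_double_half #|A :&: Q|) oA -mul2n PoszD PoszM; clear; lia.
    rewrite (rho_small k0); last by clear; lia.
    by have := cutQ A oA; move: k1; clear; lia.
  right; rewrite /exempting stubs0 eqxx; split; last by left.
  rewrite /= tot_t -(odd_double_half #|_|) (negbTE eA) add0n -mul2n PoszM.
  by rewrite mulrCA mulrA dvdz_mulr.
have [s Hs] := admissible_solvable k1 adm.
by exists s => v; apply: Hs; rewrite inE.
Qed.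

End Degrees.

Theorem theorem4p6 (k : nat) (k_gt0 : 0 < k) (V : finType) (G : mgraph V)
    (dvd_size : k %| #|edge G|)
    (dvd_deg : forall v : V, k %| deg G v)
    (Q : {set V}) (defQ : Q = [set v : V | odd (deg G v %/ k)])
    (cutQ : forall X : {set V}, odd #|X :&: Q| -> 3 * k - 2 <= cut_size G X) :
  exists F : 'I_k -> {set edge G},
    edge_decomposition F /\
    (forall (i : 'I_k) (v : V), deg (factor (F i)) v = deg G v %/ k).
Proof.
(* [s] chooses the tail of each edge; a loop counts once as an out-edge and once as an in-edge. *)
suff [s ds] : exists s : edge G -> bool, forall v,
    k %| #|[set e | (if s e then (ends e).1 else (ends e).2) == v]| /\
    k %| #|[set e | (if s e then (ends e).2 else (ends e).1) == v]|.
  have [c Hc] := equitable_colouring k_gt0 (fun v => proj1 (ds v)) (fun v => proj2 (ds v)).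
  exists (fun i => [set e | c e == i]); split.
    split=> [i j ij|].
      rewrite -setI_eq0; apply/eqP/setP=> e; rewrite !inE.
      by case: eqP => // ->; apply/negbTE.
    by apply/setP=> e; rewrite inE; apply/bigcupP; exists (c e); rewrite // inE.
  move=> i v; have [H1 H2] := Hc i v.
  have -> : deg G v = #|[set e | (if s e then (ends e).1 else (ends e).2) == v]|
                    + #|[set e | (if s e then (ends e).2 else (ends e).1) == v]|.
    rewrite deg_sum !card_set_sum -big_split; apply: eq_bigr => e _ /=.
    by case: (s e); rewrite // addnC.
  rewrite divnDl; last by have [] := ds v.
  rewrite -H1 -H2 deg_factor !card_set_sum -big_split big_mkcond.
  apply: eq_bigr => e _ /=; rewrite inE; case: (c e == i); rewrite ?andbT ?andbF //.
  by case: (s e); rewrite // addnC.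
have [k1|k1] := leqP k 1.
  by exists xpredT => v; move: k_gt0 k1; case: (k) => [|[|]] //; rewrite !dvd1n.
have [s Hs] := modular_orientation k1 dvd_size dvd_deg defQ cutQ.
exists s => v; have := Hs v.
set p := #|_|; set q := #|_|.
have Edeg : deg G v = p + q.
  rewrite deg_sum /p /q !card_set_sum -big_split; apply: eq_bigr => e _ /=.
  by case: (s e); rewrite // addnC.
have -> : net (@ends V G) [set: edge G] s [set v] = (p%:Z - q%:Z)%R.
  rewrite /p /q !card_set_sum !(big_morph Posz PoszD (erefl _)) -sumrB /net.
  rewrite big_mkcond; apply: eq_bigr => e _; rewrite inE /bnd /sg !inE /=.
  by case: (s e); case: (_ == v); case: (_ == v).
have := divnK (dvd_deg v); rewrite -{1}(odd_double_half (deg G v %/ k)) -mul2n Edeg.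
have -> : odd ((p + q) %/ k) = (v \in Q) by rewrite defQ inE Edeg.
move: (half _) => m Em /dvdzP[z Ez].
(* Adding degree and net out-degree gives [2p]; both contain the term [k] on [Q], so the factor 2
   cancels. *)
have Ep : (p%:Z = (m%:Z + (v \in Q)%:Z + z) * k%:Z)%R.
  by move: Em Ez; case: (v \in Q) => /=; clear; lia.
have dp : k %| p.
  by have : (k%:Z %| p%:Z)%Z by rewrite Ep dvdz_mull.
by split=> //; rewrite -(dvdn_addr _ dp) -Edeg.
Qed.
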